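(* For $\lambda\in\mathbb{C}$ with $\Delta_\theta(q,\lambda)\neq0$, the resolvent $R_{L_q}(\lambda^3)=(L_q(\theta)-\lambda^3I)^{-1}$ of the operator $L_q(\theta)$ is, for $f\in L^2(0,l)$, $$(R_{L_q}(\lambda^3)f)(x)=\frac i{\Delta_\theta(q,\lambda)}\left\{\int_0^l[G(\lambda,x,l)s_2^*(\lambda,t)-\theta G(\lambda,l,t)s_2(\lambda,x)]f(t)\,dt\right.$$ $$\left.+\theta\int_0^xG(\lambda,x,t)s_2(\lambda,l)f(t)\,dt-\int_x^lG(\lambda,x,t)s_2^*(\lambda,l)f(t)\,dt\right\}.$$
   Context: Let $0<l<\infty$, $\theta\in\mathbb{T}=\{z\in\mathbb{C}:|z|=1\}$, and let $q\in L^2(0,l)$ be real. $L_q(\theta)$ is the self-adjoint operator in $L^2(0,l)$, $(L_q(\theta)y)(x)=iy'''(x)+q(x)y(x)$, with domain $\{y\in W_2^3(0,l):y(0)=0,\ y'(l)=\theta y'(0),\ y(l)=0\}$. For $\lambda\in\mathbb{C}$ let $s_p(\lambda,x)$ ($p=0,1,2$) be the solutions of $iy'''+qy=\lambda^3y$ on $[0,l]$ with $s_p^{(j)}(\lambda,0)=\delta_{pj}$ ($j=0,1,2$), and put $s_p^*(\lambda,x)=\overline{s_p(\overline\lambda,x)}$. The characteristic function is $\Delta_\theta(q,\lambda)=-\{\theta s_2(\lambda,l)+s_2^*(\lambda,l)\}$, and $$G(\lambda,x,t)=s_0(\lambda,x)s_2^*(\lambda,t)-s_1(\lambda,x)s_1^*(\lambda,t)+s_2(\lambda,x)s_0^*(\lambda,t).$$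 *)

(* Defs.v *)
From HB Require Import structures.
From mathcomp Require Import all_boot all_order all_algebra.
From mathcomp Require Import all_classical all_reals all_analysis.
From mathcomp Require Export complex.

Set Implicit Arguments.
Unset Strict Implicit.
Unset Printing Implicit Defensive.

Import Order.TTheory GRing.Theory Num.Theory.
Import numFieldNormedType.Exports.

Local Open Scope classical_set_scope.
Local Open Scope ring_scope.
Local Open Scope complex_scope.

(** Complex-valued functions of a real variable are handled through their real
    and imaginary parts. *)

Definition cmeasurable (R : realType) (D : set R) (f : R -> R[i]) : Prop :=
  measurable_fun D (fun x => complex.Re (f x)) /\
  measurable_fun D (fun x => complex.Im (f x)).

Definition cintegral (R : realType) (D : set R) (f : R -> R[i]) : R[i] :=
  (\int[lebesgue_measure]_(x in D) complex.Re (f x)) +i*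
  (\int[lebesgue_measure]_(x in D) complex.Im (f x)).

Definition cderive (R : realType) (F : R -> R[i]) (x : R) (d : R[i]) : Prop :=
  is_derive x (1 : R) (fun t => complex.Re (F t) : R) (complex.Re d) /\
  is_derive x (1 : R) (fun t => complex.Im (F t) : R) (complex.Im d).

(** An element of L^2(0,l) is represented by a square-integrable function;
    [ae_on] is the equality of L^2(0,l).  Values outside ]0, l[ are junk. *)

Definition ae_on (R : realType) (l : R) (f g : R -> R[i]) : Prop :=
  {ae lebesgue_measure, forall x : R, x \in `]0, l[ -> f x = g x}.

Definition L2norm (R : realType) (l : R) (f : R -> R[i]) : \bar R :=
  Lnorm (@lebesgue_measure R) 2%:E
    ((fun x => (ComplexField.Normc.normc (f x))%:E) \_ `]0, l[%classic).

Definition L2 (R : realType) (l : R) (f : R -> R[i]) : Prop :=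
  cmeasurable `]0, l[%classic f /\ (L2norm l f < +oo)%E.

Definition abs_continuous (R : realType) (l : R) (F : R -> R[i]) : Prop :=
  forall e : R, 0 < e -> exists2 d : R, 0 < d &
    forall (n : nat) (a b : 'I_n -> R),
      (forall k, 0 <= a k /\ a k <= b k /\ b k <= l) ->
      trivIset setT (fun k => `]a k, b k[%classic) ->
      \sum_k (b k - a k) < d ->
      \sum_k ComplexField.Normc.normc (F (b k) - F (a k)) < e.

(** [Y 0], ..., [Y 3] are y, y', y'', y''', with y, y', y'' absolutely
    continuous on [0, l]; being continuous, [Y 1] and [Y 2] are determined on
    the whole of [0, l], so that boundary values of y' and y'' are values of
    [Y 1] and [Y 2], while [Y 3] is determined almost everywhere. *)
Definition ac_jet3 (R : realType) (l : R) (Y : nat -> R -> R[i]) : Prop :=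
  forall k, (k < 3)%N ->
    abs_continuous l (Y k) /\
    {ae lebesgue_measure,
      forall x : R, x \in `]0, l[ -> cderive (Y k) x (Y k.+1 x)}.

Definition W23_jet (R : realType) (l : R) (Y : nat -> R -> R[i]) : Prop :=
  ac_jet3 l Y /\ L2 l (Y 3%N).

(** i y''' + q y *)
Definition lq_expr (R : realType) (q : R -> R) (Y : nat -> R -> R[i]) (x : R) :
    R[i] :=
  'i%C * Y 3%N x + (q x)%:C * Y 0%N x.

(** A possibly unbounded operator in L^2(0,l) is given by its graph, a relation
    between representatives that is invariant under a.e. equality. *)
Definition Lq (R : realType) (l : R) (q : R -> R) (theta : R[i])
    (y g : R -> R[i]) : Prop :=
  [/\ L2 l y, L2 l g &
    exists Y : nat -> R -> R[i],
      [/\ W23_jet l Y, ae_on l y (Y 0%N),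
          [/\ Y 0%N 0 = 0, Y 1%N l = theta * Y 1%N 0 & Y 0%N l = 0] &
          ae_on l g (lq_expr q Y)]].

(** [Rz] is the resolvent (A - z I)^-1: an everywhere defined bounded operator
    that is a right and a left inverse of A - z I. In particular z belongs to
    the resolvent set of A, and [Rz] is unique up to a.e. equality. *)
Definition is_resolvent (R : realType) (l : R)
    (A : (R -> R[i]) -> (R -> R[i]) -> Prop) (z : R[i])
    (Rz : (R -> R[i]) -> R -> R[i]) : Prop :=
  [/\ forall f, L2 l f -> L2 l (Rz f),
      exists M : R, forall f, L2 l f ->
        (L2norm l (Rz f) <= M%:E * L2norm l f)%E,
      forall f, L2 l f -> A (Rz f) (fun x => f x + z * Rz f x) &
      forall y g, A y g -> ae_on l (Rz (fun x => g x - z * y x)) y].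

(** y solves i y''' + q y = lambda^3 y on [0, l], y^(j)(0) = delta_{pj}.
    As q is only in L^2, the equation holds almost everywhere. *)
Definition fundamental_solution (R : realType) (l : R) (q : R -> R)
    (lambda : R[i]) (p : nat) (y : R -> R[i]) : Prop :=
  exists Y : nat -> R -> R[i],
    [/\ ac_jet3 l Y, forall x, 0 <= x <= l -> Y 0%N x = y x,
        forall j, (j < 3)%N -> Y j 0 = (p == j)%:R &
        ae_on l (lq_expr q Y) (fun x => lambda ^+ 3 * Y 0%N x)].

Section characteristic_function.
Variables (R : realType) (s : nat -> R[i] -> R -> R[i]).

Definition star (p : nat) (lambda : R[i]) (x : R) : R[i] :=
  conjc (s p (conjc lambda) x).

Definition Delta (l : R) (theta lambda : R[i]) : R[i] :=
  - (theta * s 2%N lambda l + star 2%N lambda l).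

Definition G (lambda : R[i]) (x t : R) : R[i] :=
  s 0%N lambda x * star 2%N lambda t - s 1%N lambda x * star 1%N lambda t
  + s 2%N lambda x * star 0%N lambda t.

End characteristic_function.

(* Main.v *)
(** The solutions [s_p] of [i y''' + q y = z y] and the conjugates [s_p^*] of
    the solutions for the conjugate parameter, which solve the formally adjoint
    equation, are paired by the Lagrange form [y'' v - y' v' + y v''], which is
    constant along solutions.  As the Wronskian of the [s_p] is 1, this
    expresses the [s_p^*] as its 2x2 cofactors, so that [G(x, x) = G_x(x, x) = 0]
    and [G_xx(x, x) = 1], and [-i \int_0^x G(x, t) f(t) dt] solves the
    inhomogeneous equation by variation of constants.  The remaining terms of
    the formula are the combination of [s_1] and [s_2] that restores the boundary
    conditions, whose determinant is [-Delta].  Since [q] and [f] are only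
    square-integrable, every constancy argument rests on the fact that an
    absolutely continuous function with zero derivative almost everywhere is
    constant. *)

Require Import Defs.
From mathcomp Require Import all_boot all_order all_algebra.
From mathcomp Require Import all_classical all_reals all_analysis.
From mathcomp Require Import measurable_realfun ring lra.

Set Implicit Arguments.
Unset Strict Implicit.
Unset Printing Implicit Defensive.

Import Order.TTheory GRing.Theory Num.Theory.
Import numFieldNormedType.Exports.

Local Open Scope classical_set_scope.
Local Open Scope ring_scope.
Local Open Scope complex_scope.

Local Notation normc := ComplexField.Normc.normc.

(** * Absolutely continuous functions *)

Section Normc.
Variable R : realType.
Implicit Types (x y : R[i]).

(** The equation is used in the form y''' = c y with c = -i (z - q). Since q is real, conjugating
    the equation for the parameter [conjc lambda] turns c into -c, and this sign is what makes the
    Lagrange form constant. The same pairings give uniqueness for the initial value problem: a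
    solution with zero initial data pairs to zero with a fundamental system of the adjoint equation,
    hence vanishes, without a Gronwall estimate.

    For the constancy of functions with zero derivative almost everywhere no covering theorem is
    invoked. The exceptional null set is enclosed in an open set of small measure, and a supremum
    argument cuts the interval into pieces that either have small slope or lie in that open set,
    where absolute continuity makes the increments negligible.

    The kernel G is a sum of three products, so the formula sees f only through three moments, the
    integrals of f against the adjoint solutions. The shape of the formula, the boundary conditions
    and the norm bound thereby become finite algebra in values at l. The left inverse property comes
    from uniqueness for the homogeneous boundary value problem. *)

Lemma normcD x y : normc (x + y) <= normc x + normc y.
Proof. exact: (@le_normcD R x y). Qed.

Lemma normcN x : normc (- x) = normc x.
Proof. exact: (@complex.normcN R x). Qed.

Lemma normc_ge0 x : 0 <= normc x.
Proof. by case: x => a b /=; exact: sqrtr_ge0. Qed.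

Lemma normc_real (a : R) : normc a%:C = `|a|.
Proof. by rewrite /= expr0n /= addr0 sqrtr_sqr. Qed.

Lemma sqr_normcE x : normc x ^+ 2 = complex.Re x ^+ 2 + complex.Im x ^+ 2.
Proof. by case: x => a b /=; rewrite sqr_sqrtr // addr_ge0 // sqr_ge0. Qed.

Lemma normcJ x : normc (conjc x) = normc x.
Proof. by case: x => a b /=; rewrite sqrrN. Qed.

Lemma normRe_le x : `|complex.Re x| <= normc x.
Proof.
rewrite -(@ler_pXn2r _ 2) ?nnegrE ?normr_ge0 ?normc_ge0//.
by rewrite sqr_normcE real_normK ?num_real// lerDl sqr_ge0.
Qed.

Lemma normIm_le x : `|complex.Im x| <= normc x.
Proof.
rewrite -(@ler_pXn2r _ 2) ?nnegrE ?normr_ge0 ?normc_ge0//.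
by rewrite sqr_normcE real_normK ?num_real// lerDr sqr_ge0.
Qed.

Lemma normc_le_ReIm x : normc x <= `|complex.Re x| + `|complex.Im x|.
Proof.
rewrite -(@ler_pXn2r _ 2) ?nnegrE ?addr_ge0 ?normc_ge0//.
rewrite sqr_normcE sqrrD !real_normK ?num_real//.
have := mulr_ge0 (normr_ge0 (complex.Re x)) (normr_ge0 (complex.Im x)).
by move=> h; rewrite -addrA lerD2l lerDr mulrn_wge0.
Qed.

Lemma cReM x y : complex.Re (x * y) =
  complex.Re x * complex.Re y - complex.Im x * complex.Im y.
Proof. by case: x y => [a b] [c d]. Qed.

Lemma cImM x y : complex.Im (x * y) =
  complex.Re x * complex.Im y + complex.Im x * complex.Re y.
Proof. by case: x y => [a b] [c d]. Qed.

Lemma cReD x y : complex.Re (x + y) = complex.Re x + complex.Re y.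
Proof. by case: x y => [a b] [c d]. Qed.

Lemma cImD x y : complex.Im (x + y) = complex.Im x + complex.Im y.
Proof. by case: x y => [a b] [c d]. Qed.

Lemma cReN x : complex.Re (- x) = - complex.Re x.
Proof. by case: x => [a b]. Qed.

Lemma cImN x : complex.Im (- x) = - complex.Im x.
Proof. by case: x => [a b]. Qed.

End Normc.

Section AbsoluteContinuity.
Variables (R : realType) (l : R).
Implicit Types (F G : R -> R[i]).

(** The closure properties below reduce to this comparison of increments. Two comparison functions
    are allowed because an increment of a sum or product involves the increments of both terms. In
    the proof [|K| + 1] replaces [K] so that one can divide by it. *)
Lemma abs_continuous_dominated F G1 G2 (K : R) :
  abs_continuous l G1 -> abs_continuous l G2 ->
  (forall x y, 0 <= x -> x <= y -> y <= l ->
     normc (F y - F x) <= K * (normc (G1 y - G1 x) + normc (G2 y - G2 x))) ->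
  abs_continuous l F.
Proof.
move=> ac1 ac2 le e e0.
have K0 : 0 < `|K| + 1 by rewrite ltr_wpDl.
have e20 : 0 < e / (`|K| + 1) / 2 by rewrite !divr_gt0.
have [d1 d10 H1] := ac1 _ e20; have [d2 d20 H2] := ac2 _ e20.
exists (Num.min d1 d2); first by rewrite lt_min d10.
move=> n a b ab tr; rewrite lt_min => /andP[sd1 sd2].
have {H1}h1 := H1 n a b ab tr sd1; have {H2}h2 := H2 n a b ab tr sd2.
apply: (@le_lt_trans _ _ ((`|K| + 1) *
  (\sum_k normc (G1 (b k) - G1 (a k)) + \sum_k normc (G2 (b k) - G2 (a k))))).
  rewrite -big_split mulr_sumr; apply: ler_sum => k _.
  have [a0 [akb bl]] := ab k.
  apply: le_trans (le _ _ a0 akb bl) _.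
  apply: ler_wpM2r; first by rewrite addr_ge0 ?normc_ge0.
  by rewrite (le_trans (ler_norm K)) // lerDl.
have -> : e = (`|K| + 1) * (e / (`|K| + 1) / 2 + e / (`|K| + 1) / 2).
  by field; rewrite gt_eqF.
by rewrite ltr_pM2l // ltrD.
Qed.

Lemma abs_continuous_cst (c : R[i]) : abs_continuous l (fun=> c).
Proof.
move=> e e0; exists 1 => // n a b _ _ _; rewrite big1 // => k _.
by rewrite subrr ComplexField.Normc.normc0.
Qed.

Lemma abs_continuousD F G : abs_continuous l F -> abs_continuous l G ->
  abs_continuous l (fun x => F x + G x).
Proof.
move=> acF acG; apply: (abs_continuous_dominated (K := 1) acF acG) => x y _ _ _.
rewrite mul1r; have -> : F y + G y - (F x + G x) = (F y - F x) + (G y - G x).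
  by ring.
exact: normcD.
Qed.

Lemma abs_continuous_conj F :
  abs_continuous l F -> abs_continuous l (fun x => conjc (F x)).
Proof.
move=> acF; apply: (abs_continuous_dominated (K := 1) acF acF) => x y _ _ _.
by rewrite mul1r -rmorphB normcJ lerDl normc_ge0.
Qed.

Lemma abs_continuous_uniform F e : abs_continuous l F -> 0 < e ->
  exists2 d : R, 0 < d & forall x y, 0 <= x -> x <= y -> y <= l -> y - x < d ->
    normc (F y - F x) < e.
Proof.
move=> acF e0; have [d d0 H] := acF e e0; exists d => // x y x0 xy yl yxd.
have := H 1%N (fun=> x) (fun=> y); rewrite !big_ord1; apply => //.
by move=> i j; rewrite (ord1 i) (ord1 j).
Qed.

(** A step of length [d / 2] changes [F] by less than 1, so the bound is the value at 0 plus the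
    number of steps needed to reach [l]. *)
Lemma abs_continuous_bounded F : abs_continuous l F ->
  exists2 M : R, 0 < M & forall x, 0 <= x <= l -> normc (F x) <= M.
Proof.
move=> acF; have [d d0 H] := abs_continuous_uniform acF ltr01.
have P (n : nat) x : 0 <= x <= l -> x <= d / 2 * n%:R ->
    normc (F x) <= normc (F 0) + n%:R.
  elim: n x => [|n IHn] x /andP[x0 xl].
    by rewrite mulr0 addr0 => x0'; have -> : x = 0 by apply/le_anti/andP.
  move=> xn; have [xd|dx] := leP x (d / 2).
    have /ltW h : normc (F x - F 0) < 1 by apply: H => //; lra.
    have -> : F x = F 0 + (F x - F 0) by rewrite addrC subrK.
    apply: le_trans (normcD _ _) _; rewrite lerD2l; apply: le_trans h _.
    by rewrite ler1n.
  have /ltW h : normc (F x - F (x - d / 2)) < 1 by apply: H => //; lra.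
  have -> : F x = F (x - d / 2) + (F x - F (x - d / 2)) by rewrite addrC subrK.
  apply: le_trans (normcD _ _) _; rewrite -[n.+1%:R]natr1 addrA; apply: lerD => //.
  apply: IHn; first by apply/andP; split; lra.
  move: xn; rewrite -[n.+1%:R]natr1 mulrDr mulr1; lra.
exists (normc (F 0) + (Num.truncn (l / (d / 2))).+1%:R).
  by rewrite ltr_wpDl ?normc_ge0 ?ltr0n.
move=> x xl; apply: P => //; case/andP: xl => _ xl; apply: le_trans xl _.
rewrite mulrC -ler_pdivrMr ?divr_gt0 //; apply: ltW; exact: truncnS_gt.
Qed.

Lemma abs_continuousM F G : abs_continuous l F -> abs_continuous l G ->
  abs_continuous l (fun x => F x * G x).
Proof.
move=> acF acG.
have [M M0 FM] := abs_continuous_bounded acF.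
have [N N0 GN] := abs_continuous_bounded acG.
apply: (abs_continuous_dominated (K := M + N) acF acG) => x y x0 xy yl.
have -> : F y * G y - F x * G x = F y * (G y - G x) + (F y - F x) * G x by ring.
apply: le_trans (normcD _ _) _; rewrite !ComplexField.Normc.normcM.
have h1 : normc (F y) <= M by apply: FM; rewrite yl (le_trans x0).
have h2 : normc (G x) <= N by apply: GN; rewrite x0 (le_trans xy).
have := normc_ge0 (F y); have := normc_ge0 (G x).
have := normc_ge0 (F y - F x); have := normc_ge0 (G y - G x).
move: (normc _) (normc (F y - F x)) (normc (F y)) (normc (G x)) h1 h2.
by move=> *; nra.
Qed.

Lemma abs_continuousZ (c : R[i]) F : abs_continuous l F ->
  abs_continuous l (fun x => c * F x).
Proof. by move=> acF; apply: abs_continuousM => //; exact: abs_continuous_cst. Qed.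

Lemma abs_continuousN F : abs_continuous l F -> abs_continuous l (fun x => - F x).
Proof.
by move=> /(abs_continuousZ (-1)); congr abs_continuous; apply/funext => x; ring.
Qed.

Lemma abs_continuous_eq F G : (forall x, 0 <= x <= l -> F x = G x) ->
  abs_continuous l F -> abs_continuous l G.
Proof.
move=> FG acF; apply: (abs_continuous_dominated (K := 1) acF acF) => x y x0 xy yl.
by rewrite !FG ?x0 ?yl ?(le_trans x0) ?(le_trans xy) // mul1r lerDl normc_ge0.
Qed.

End AbsoluteContinuity.

(** * Absolutely continuous functions whose derivative vanishes almost everywhere *)

Section ZeroDerivative.
Variable R : realType.
Local Notation mu := (@lebesgue_measure R).

Lemma is_derive0_slope (f : R -> R) (x e : R) : is_derive x (1 : R) f 0 -> 0 < e ->
  exists2 r : R, 0 < r & forall y, `|y - x| < r -> `|f y - f x| <= e * `|y - x|.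
Proof.
move=> [df dfx] e0; have : _ --> 'D_1 f x := df; rewrite dfx => {}df.
have /cvgr0Pnorm_le /(_ e e0) := df.
case/nbhs_ballP => r /= r0 H; exists r => // y yr.
have [->|yx] := eqVneq y x; first by rewrite !subrr normr0 mulr0.
have := H (y - x); rewrite -ball_normE /= sub0r normrN => /(_ yr).
rewrite subr_eq0 => /(_ yx).
rewrite /= [_ *: 1]mulr1 subrK normrM normfV mulrC ler_pdivrMr //.
by rewrite normr_gt0 subr_eq0.
Qed.

(** Straddle estimate: as [y <= x <= z], the increments on the two sides of [x] have lengths adding
    up to exactly [z - y], so no constant is lost. *)
Lemma cderive0_slope (F : R -> R[i]) (x e : R) : cderive F x 0 -> 0 < e ->
  exists2 r : R, 0 < r & forall y z, x - r < y -> y <= x -> x <= z -> z < x + r ->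
    normc (F z - F y) <= e * (z - y).
Proof.
move=> [dRe dIm] e0; have e20 : 0 < e / 2 by rewrite divr_gt0.
have [r1 r10 H1] := is_derive0_slope dRe e20.
have [r2 r20 H2] := is_derive0_slope dIm e20.
exists (Num.min r1 r2); first by rewrite lt_min r10.
have H y : `|y - x| < Num.min r1 r2 -> normc (F y - F x) <= e * `|y - x|.
  rewrite lt_min => /andP[h1 h2]; apply: le_trans (normc_le_ReIm _) _.
  rewrite !cReD !cImD !cReN !cImN; have := H1 y h1; have := H2 y h2; lra.
move: (Num.min r1 r2) H => r H y z xry yx xz zxr.
have -> : F z - F y = (F z - F x) + - (F y - F x) by ring.
apply: le_trans (normcD _ _) _; rewrite normcN.
have hy : `|y - x| = x - y by rewrite distrC ger0_norm // subr_ge0.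
have hz : `|z - x| = z - x by rewrite ger0_norm // subr_ge0.
have := H y; have := H z; rewrite hy hz => h1 h2.
have {}h1 := h1 (ltac:(lra)); have {}h2 := h2 (ltac:(lra)).
by apply: le_trans (lerD h1 h2) _; rewrite -mulrDr addrA subrK.
Qed.

(* A partition of [0, x] subordinate to the gauge given by the slopes: its
   increments are small except on disjoint intervals contained in [U]. *)
Definition gauge_partition (U : set R) (F : R -> R[i]) (e x : R) : Prop :=
  exists (n : nat) (a b : nat -> R),
   [/\ forall k, (k < n)%N -> [/\ 0 <= a k, a k <= b k, b k <= x &
         `]a k, b k[%classic `<=` U],
       forall j k, (j < k)%N -> (k < n)%N -> b j <= a k &
       normc (F x - F 0) <= e * x + \sum_(k < n) normc (F (b k) - F (a k))].

Lemma gauge_partition_slope U F e x y : x <= y -> gauge_partition U F e x ->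
  normc (F y - F x) <= e * (y - x) -> gauge_partition U F e y.
Proof.
move=> xy [n [a [b [ab dis Fx]]]] Fxy; exists n, a, b; split => //.
  by move=> k kn; have [? ? bx ?] := ab k kn; split => //; exact: le_trans xy.
have -> : F y - F 0 = (F x - F 0) + (F y - F x) by ring.
apply: le_trans (normcD _ _) _; move: Fx Fxy; rewrite mulrBr; lra.
Qed.

Lemma gauge_partition_itv U F e x y : 0 < e -> 0 <= x -> x <= y ->
  gauge_partition U F e x ->
  `]x, y[%classic `<=` U -> gauge_partition U F e y.
Proof.
move=> e0 x0 xy [n [a [b [ab dis Fx]]]] xyU.
pose a' k := if (k < n)%N then a k else x.
pose b' k := if (k < n)%N then b k else y.
exists n.+1, a', b'; split.
- move=> k; rewrite ltnS /a' /b' => kn; case: ltnP => [/ab[? ? bx ?]|] //.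
  by split => //; exact: le_trans xy.
- move=> j k jk; rewrite ltnS /a' /b' => kn; rewrite (leq_trans jk kn).
  case: ltnP => [kn'|nk]; first exact: dis.
  by have [] := ab j (leq_trans jk kn).
- rewrite big_ord_recr /= /a' /b' ltnn.
  under eq_bigr => i _ do rewrite ltn_ord.
  have -> : F y - F 0 = (F x - F 0) + (F y - F x) by ring.
  apply: le_trans (normcD _ _) _; rewrite addrA lerD2r; apply: le_trans Fx _.
  by rewrite lerD2r ler_wpM2l // ltW.
Qed.

(** Continuous induction: the supremum [c] of the points reachable by a partition is either in the
    open set [U] or a point of zero derivative, and in both cases a partition ending just before [c]
    can be prolonged beyond it. *)
Lemma gauge_partition_total (l : R) U F e : 0 < l -> 0 < e -> open U ->
  (forall x, 0 <= x <= l -> ~ U x -> cderive F x 0) -> gauge_partition U F e l.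
Proof.
move=> l0 e0 oU dF.
pose S := [set x | 0 <= x <= l /\ gauge_partition U F e x].
have S0 : S 0.
  split; first by rewrite lexx ltW.
  exists 0%N, (fun=> 0), (fun=> 0); split => //.
  by rewrite big_ord0 subrr ComplexField.Normc.normc0 mulr0 addr0.
have Sl : ubound S l by move=> x [/andP[]].
have supS : has_sup S by split; [exists 0 | exists l].
set c := sup S.
have c0 : 0 <= c by apply: ub_le_sup => //; exists l.
have cl : c <= l by apply: ge_sup => //; exists 0.
have [r r0 H] : exists2 r : R, 0 < r & forall y z, 0 <= y -> c - r < y -> y <= c ->
    c <= z -> z < c + r -> gauge_partition U F e y -> gauge_partition U F e z.
  have [Uc|nUc] := pselect (U c).
    have /nbhs_ballP[r /= r0 rU] := open_nbhs_nbhs (conj oU Uc).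
    exists r => // y z y0 cry yc cz zcr P.
    apply: (gauge_partition_itv e0 y0 _ P); first exact: le_trans cz.
    move=> t /=; rewrite in_itv /= => /andP[yt tz]; apply: rU.
    by rewrite -ball_normE /= ltr_norml; apply/andP; split; lra.
  have cc : 0 <= c <= l by rewrite c0 cl.
  have [r r0 rF] := cderive0_slope (dF c cc nUc) e0.
  exists r => // y z y0 cry yc cz zcr P.
  by apply: (gauge_partition_slope _ P); [exact: le_trans cz | exact: rF].
have [y [/andP[y0 yl] Py] cry] := sup_adherent r0 supS.
have yc : y <= c by apply: ub_le_sup; [exists l | split; rewrite ?y0].
(* The point reached is truncated at [l] to stay in the interval. Being in [S] it cannot exceed [c],
   so the truncation must have occurred and the point is [l]. *)
have P : gauge_partition U F e (Num.min l (c + r / 2)).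
  apply: (H y) => //; first by rewrite le_min cl /=; lra.
  by rewrite gt_min; apply/orP; right; lra.
have le_c : Num.min l (c + r / 2) <= c.
  apply: ub_le_sup; first by exists l.
  split => //; rewrite ge_min lexx /= le_min (ltW l0) /=; lra.
have lc : l <= c + r / 2.
  by rewrite leNgt; apply/negP => h; move: le_c; rewrite (min_r (ltW h)); lra.
by move: P; rewrite min_l.
Qed.

(** The exceptional intervals are disjoint and contained in [U], so their total length is below [d]
    and absolute continuity bounds the sum of their increments by [e]; the other pieces contribute
    at most [e * x]. *)
Lemma gauge_partition_small U F (l d e x : R) : measurable U ->
  (mu U < d%:E)%E -> 0 <= x <= l ->
  (forall (n : nat) (a b : 'I_n -> R),
      (forall k, 0 <= a k /\ a k <= b k /\ b k <= l) ->
      trivIset setT (fun k => `]a k, b k[%classic) ->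
      \sum_k (b k - a k) < d ->
      \sum_k normc (F (b k) - F (a k)) < e) ->
  gauge_partition U F e x -> normc (F x - F 0) <= e * x + e.
Proof.
move=> mU Ud /andP[x0 xl] ac [n [a [b [ab dis Fx]]]]; apply: le_trans Fx _.
rewrite lerD2l; apply: ltW.
have tr : trivIset [set: 'I_n] (fun k => `]a k, b k[%classic).
  apply/trivIsetP => i j _ _ ij; apply/seteqP; split => // t [] /=.
  rewrite !in_itv /= => /andP[ait tbi] /andP[ajt tbj].
  have /orP[lt|lt] : (i < j)%N || (j < i)%N by rewrite -neq_ltn.
    by have := dis _ _ lt (ltn_ord j); lra.
  by have := dis _ _ lt (ltn_ord i); lra.
apply: ac => // [k|].
  by have [? ? bx _] := ab k (ltn_ord k); split => //; split => //; exact: le_trans xl.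
rewrite -lte_fin; apply: le_lt_trans Ud.
rewrite (_ : (_%:E = mu (\big[setU/set0]_(k < n) `]a k, b k[%classic))%E).
  apply: le_measure; rewrite ?inE //; first exact: bigsetU_measurable.
  apply: (big_ind (fun X : set R => X `<=` U)) => // [X Y XU YU|k _].
    by rewrite subUset.
  by have [_ _ _] := ab k (ltn_ord k).
rewrite measure_bigsetU_ord // -sumEFin; apply: eq_bigr => k _.
have [_ akb _ _] := ab k (ltn_ord k).
rewrite [RHS](lebesgue_measure_itv `]a k, b k[) /= lte_fin.
by case: ltgtP akb => // -> _; rewrite subrr.
Qed.

(** Outer regularity encloses the exceptional null set in an open set of measure less than [d],
    where [d] answers the tolerance in the definition of absolute continuity; the gauge partitions
    then bound the increment by an arbitrary [e]. *)
Lemma abs_continuous_derive0 (l : R) (F : R -> R[i]) : 0 < l -> abs_continuous l F ->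
  {ae mu, forall x, x \in `]0, l[ -> cderive F x 0} ->
  forall x, 0 <= x <= l -> F x = F 0.
Proof.
have main k (k0 : 0 < k) : abs_continuous k F ->
    {ae mu, forall x, x \in `]0, k[ -> cderive F x 0} -> F k = F 0.
  move=> acF [N [mN N0 dF]].
  suff h e : 0 < e -> normc (F k - F 0) <= e.
    apply/eqP; rewrite -subr_eq0; apply/eqP/ComplexField.Normc.eq0_normc.
    apply/le_anti; rewrite normc_ge0 andbT; apply/ler_addgt0Pl => e e0.
    by rewrite addr0; exact: h.
  (* Chosen so that the slope part [e' * k] and the exceptional part [e'] add up to [e]. *)
  move=> e0; pose e' := e / (k + 1).
  have k1 : 0 < k + 1 by lra.
  have e'0 : 0 < e' by rewrite divr_gt0.
  have [d d0 acd] := acF e' e'0.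
  (* The endpoints join the null set because the derivative is only controlled inside the open
     interval. *)
  pose N' := N `|` ([set 0] `|` [set k]).
  have mN' : measurable N' by apply: measurableU => //; exact: measurableU.
  have N'0 : mu N' = 0%E.
    apply/negligibleP => //; apply: negligibleU; first exact/negligibleP.
    by apply: negligibleU; apply/negligibleP => //; exact: lebesgue_measure_set1.
    have N'y : (mu N' < +oo)%E by rewrite N'0 ltry.
  have [U [oU NU UNd]] := lebesgue_regularity_outer mN' N'y d0.
  have mU : measurable U by exact: open_measurable.
  have Ud : (mu U < d%:E)%E.
    apply: le_lt_trans UNd.
    rewrite -[X in (mu X <= _)%E](setDUK NU).
    apply: le_trans (measureU2 _ _ _) _ => //; first exact: measurableD.
    by rewrite [X in (X + _ <= _)%E](N'0 : _ = 0%E) add0e.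
  have P : gauge_partition U F e' k.
    apply: gauge_partition_total => // x /andP[x0 xk] nUx.
    apply: contrapT => ndF; apply: nUx; apply: NU.
    have [->|xn0] := eqVneq x 0; first by right; left.
    have [->|xnk] := eqVneq x k; first by right; right.
    left; apply: dF => /=; apply: contra_not ndF; apply.
    by rewrite in_itv /= !lt_neqAle x0 xk eq_sym xn0 xnk.
  have kk : 0 <= k <= k by rewrite lexx ltW.
  have := gauge_partition_small mU Ud kk acd P.
  suff -> : e' * k + e' = e by [].
  by rewrite /e'; field; rewrite gt_eqF.
(* [main] compares only the two endpoints of an interval, so it is applied to [[0, x]] for each
   [x]. *)
move=> l0 acF dF x /andP[x0 xl]; have [->//|xn0] := eqVneq x 0.
apply: main; first by rewrite lt_neqAle eq_sym xn0.
  move=> e e0; have [d d0 H] := acF e e0; exists d => // n a b ab tr sd.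
  apply: H => // k; have [? [? bx]] := ab k; split => //; split => //.
  exact: le_trans xl.
apply: filterS dF; first exact: (ae_filter_ringOfSetsType mu).
move=> t H /=; rewrite in_itv /= => /andP[t0 tx]; apply: H.
by rewrite in_itv /= t0 (lt_le_trans tx).
Qed.

End ZeroDerivative.

(** * Primitives of integrable functions *)

Section Primitive.
Variable R : realType.
Local Notation mu := (@lebesgue_measure R).

(** The sum of the increments is at most the integral of [|h|] over the union of the intervals,
    which is small once the measure of the union is. *)
Lemma abs_continuous_Rintegral (l : R) (h : R -> R) :
  mu.-integrable setT (EFin \o h) ->
  abs_continuous l (fun x => (\int[mu]_(t in `[0, x]) h t)%:C).
Proof.
move=> inth e e0; have [d [d0 H]] := integral_normr_continuous inth e0.
have intn A : measurable A -> mu.-integrable A (EFin \o (Num.norm \o h)).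
  by move=> mA; apply: integrableS (integrable_norm inth).
exists d => // n a b ab tr sd.
have mA (k : 'I_n) : measurable `]a k, b k[%classic by [].
have mD : measurable (\big[setU/set0]_(k < n) `]a k, b k[%classic).
  exact: bigsetU_measurable.
have muD : (mu (\big[setU/set0]_(k < n) `]a k, b k[%classic) < d%:E)%E.
  rewrite measure_bigsetU_ord // -lte_fin -sumEFin in sd *.
  apply: le_lt_trans sd; apply: lee_sum => k _.
  have [_ [akb _]] := ab k.
  rewrite [leLHS](lebesgue_measure_itv `]a k, b k[) /= lte_fin.
  by case: ifP => // _; rewrite lee_fin subr_ge0.
have E : \int[mu]_(x in \big[setU/set0]_(k < n) `]a k, b k[%classic) `|h x| =
    \sum_(k < n) \int[mu]_(x in `]a k, b k[) `|h x|.
  rewrite /Rintegral (integral_bigsetU_EFin mu mA) //=; last 3 first.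
  - exact: index_enum_uniq.
  - exact: sub_trivIset tr.
  - by case/integrableP: (intn _ mD).
  by rewrite sum_fine // => k _; apply: integrable_fin_num => //; exact: intn.
apply: le_lt_trans (H _ mD muD); rewrite [leRHS]E.
apply: ler_sum => k _; have [a0 [akb bl]] := ab k.
rewrite -rmorphB normc_real.
rewrite (@Rintegral_itvB _ _ (BLeft 0) (BRight (b k)) (a k)) //; last first.
  by apply: integrableS inth.
rewrite -Rintegral_itv_bndo_bndc; last by apply: integrableS inth.
apply: le_normr_Rintegral => //; exact: integrableS inth.
Qed.

Lemma is_derive_Rintegral (h : R -> R) : mu.-integrable setT (EFin \o h) ->
  {ae mu, forall x : R, 0 < x ->
     is_derive x (1 : R) (fun y : R => \int[mu]_(t in `[0, y]) h t) (h x)}.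
Proof.
move=> inth; have loch : locally_integrable [set: R] h.
  by rewrite -(@patch_setT _ _ (fun=> 0) h); exact: integrable_locally.
have inty y : mu.-integrable [set` Interval (BLeft 0) (BRight y)] (EFin \o h).
  exact: integrableS inth.
apply: filterS (FTC1 inty loch); first exact: (ae_filter_ringOfSetsType mu).
move=> x H x0; have [|dF Fx] := H; first by rewrite /= lte_fin.
by apply: DeriveDef dF _; rewrite -derive1E.
Qed.

Definition cintegrable (D : set R) (f : R -> R[i]) : Prop :=
  mu.-integrable D (EFin \o (fun x => complex.Re (f x))) /\
  mu.-integrable D (EFin \o (fun x => complex.Im (f x))).

Lemma primitive_exists (l : R) (h : R -> R[i]) : cintegrable `[0, l] h ->
  exists F : R -> R[i], [/\ abs_continuous l F,
    forall x, 0 <= x <= l -> F x = cintegral `[0, x] h &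
    {ae mu, forall x, x \in `]0, l[ -> cderive F x (h x)}].
Proof.
move=> [intRe intIm].
(* Lebesgue differentiation is applied to functions integrable on the whole line, hence the
   extension by zero; integrals over [[0, x]] with [x <= l] do not change. *)
pose r := (fun x => complex.Re (h x)) \_ `[0, l].
pose i := (fun x => complex.Im (h x)) \_ `[0, l].
have intr : mu.-integrable setT (EFin \o r).
  rewrite /r -restrict_EFin; apply: (integrable_mkcond _ _).1 => //.
have inti : mu.-integrable setT (EFin \o i).
  rewrite /i -restrict_EFin; apply: (integrable_mkcond _ _).1 => //.
have itv x t : x <= l -> t \in `[0, x]%classic -> t \in `[0, l]%classic.
  by move=> xl; rewrite !inE /= !in_itv /= => /andP[-> /le_trans->].
exists (fun x => (\int[mu]_(t in `[0, x]) r t) +i* (\int[mu]_(t in `[0, x]) i t)).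
split.
- apply: (@abs_continuous_eq _ _ (fun x => (\int[mu]_(t in `[0, x]) r t)%:C
               + 'i%C * (\int[mu]_(t in `[0, x]) i t)%:C)).
    by move=> x _; rewrite [RHS]complexE.
  apply: abs_continuousD; first exact: abs_continuous_Rintegral.
  by apply: abs_continuousZ; exact: abs_continuous_Rintegral.
- move=> x /andP[_ xl]; rewrite /cintegral.
  by congr Complex; apply: eq_Rintegral => t /(itv _ _ xl) tl;
    rewrite ?/r ?/i patchE tl.
- apply: filterS2 (is_derive_Rintegral intr) (is_derive_Rintegral inti).
    exact: (ae_filter_ringOfSetsType mu).
  move=> x dr di; rewrite in_itv /= => /andP[x0 xl].
  have xin : x \in `[0, l]%classic by rewrite inE /= in_itv /= !ltW.
  by split; [move: (dr x0) | move: (di x0)]; rewrite /r /i patchE xin.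
Qed.

End Primitive.

(** * Lebesgue integrals and square-integrable functions *)

Section Lebesgue.
Variables (R : realType) (l : R).
Hypothesis l_gt0 : 0 < l.
Local Notation mu := (@lebesgue_measure R).
Local Notation D := (`]0, l[%classic : set R).
Implicit Types (f g h : R -> R[i]).

Lemma measurable_normc (A : set R) f : cmeasurable A f ->
  measurable_fun A (fun x => normc (f x)).
Proof.
move=> [mRe mIm].
have -> : (fun x => normc (f x)) =
    (fun x => (complex.Re (f x) ^+ 2 + complex.Im (f x) ^+ 2) `^ 2^-1).
  apply/funext => x; rewrite powR12_sqrt ?addr_ge0 ?sqr_ge0 //.
  by case: (f x).
apply: (measurableT_comp (measurable_powR _)).
by apply: measurable_funD; exact: measurable_funX.
Qed.

Lemma cmeasurableD (A : set R) f g : cmeasurable A f -> cmeasurable A g ->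
  cmeasurable A (fun x => f x + g x).
Proof.
move=> [f1 f2] [g1 g2]; split.
  by under eq_fun do rewrite cReD; exact: measurable_funD.
by under eq_fun do rewrite cImD; exact: measurable_funD.
Qed.

Lemma cmeasurableM (A : set R) f g : cmeasurable A f -> cmeasurable A g ->
  cmeasurable A (fun x => f x * g x).
Proof.
move=> [f1 f2] [g1 g2]; split.
  under eq_fun do rewrite cReM.
  by apply: measurable_funB; exact: measurable_funM.
under eq_fun do rewrite cImM.
by apply: measurable_funD; exact: measurable_funM.
Qed.

Lemma cmeasurable_cst (A : set R) (c : R[i]) : cmeasurable A (fun=> c).
Proof. by split; exact: measurable_cst. Qed.

Lemma cmeasurable_eq (A : set R) f g : (forall x, A x -> f x = g x) ->
  cmeasurable A f -> cmeasurable A g.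
Proof.
move=> fg [f1 f2]; split.
  by apply: eq_measurable_fun f1 => x /set_mem /fg ->.
by apply: eq_measurable_fun f2 => x /set_mem /fg ->.
Qed.

Lemma cmeasurableS (A B : set R) f : measurable B -> A `<=` B ->
  cmeasurable B f -> cmeasurable A f.
Proof. by move=> mB AB [f1 f2]; split; exact: measurable_funS mB AB _. Qed.

(** Real and imaginary parts are continuous on the closed interval. Continuity is taken in the
    subspace topology, since nothing is known of [f] outside [[0, l]]. *)
Lemma abs_continuous_measurable f : abs_continuous l f ->
  cmeasurable `[0, l]%classic f.
Proof.
have cont (u : R -> R) : abs_continuous l f ->
    (forall x y, `|u y - u x| <= normc (f y - f x)) ->
    measurable_fun `[0, l]%classic u.
  move=> acf uf; apply: subspace_continuous_measurable_fun => //.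
  apply/subspace_continuousP => x /=; rewrite in_itv /= => /andP[x0 xl].
  apply/cvgrPdist_lt => e e0; have [d d0 H] := abs_continuous_uniform acf e0.
  rewrite near_withinE; apply/nbhs_ballP; exists d => //= y.
  rewrite -ball_normE /= => xyd; rewrite in_itv /= => /andP[y0 yl].
  have [xy|/ltW yx] := leP x y.
    rewrite distrC; apply: le_lt_trans (uf x y) _; apply: H => //.
    by move: xyd; rewrite distrC ger0_norm // subr_ge0.
  apply: le_lt_trans (uf y x) _; apply: H => //.
  by move: xyd; rewrite ger0_norm // subr_ge0.
move=> acf; split; apply: (cont _ acf) => x y.
  by rewrite -cReN -cReD normRe_le.
by rewrite -cImN -cImD normIm_le.
Qed.

Lemma L2normE f : L2norm l f =
  ((\int[mu]_(x in D) (normc (f x) ^+ 2)%:E) `^ 2^-1)%E.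
Proof.
rewrite /L2norm unlock; congr (_ `^ _)%E; rewrite [RHS]integral_mkcond.
apply: eq_integral => x _ /=; rewrite !patchE; case: ifP => _ /=.
  by rewrite ger0_norm ?normc_ge0 // powR_mulrn // normc_ge0.
transitivity ((`|0 : R| `^ 2)%:E) => //.
by rewrite normr0 powR0.
Qed.

Lemma L2P f : L2 l f <->
  cmeasurable D f /\ (\int[mu]_(x in D) (normc (f x) ^+ 2)%:E < +oo)%E.
Proof.
rewrite /L2 L2normE; split => -[mf fy]; split => //.
  by apply: lty_poweRy fy.
by apply: poweR_lty.
Qed.

Lemma measurable_sqr_normc (A : set R) f : cmeasurable A f ->
  measurable_fun A (fun x => (normc (f x) ^+ 2)%:E).
Proof.
by move=> mf; apply/measurable_EFinP; apply: measurable_funX; exact: measurable_normc.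
Qed.

(** Integrate [(K (a + b))^2 <= 2 K^2 (a^2 + b^2)], which is the nonnegativity of
    [K^2 (a - b)^2]. *)
Lemma L2_dominated (K : R) f g h : cmeasurable D h -> L2 l f -> L2 l g ->
  (forall x, D x -> normc (h x) <= K * (normc (f x) + normc (g x))) -> L2 l h.
Proof.
move=> mh /L2P[mf fy] /L2P[mg gy] le; apply/L2P; split => //.
have K0 : 0 <= 2 * K ^+ 2 by rewrite mulr_ge0 // sqr_ge0.
apply: (@le_lt_trans _ _ (\int[mu]_(x in D) ((2 * K ^+ 2)%:E *
  ((normc (f x) ^+ 2)%:E + (normc (g x) ^+ 2)%:E)))%E).
  apply: ge0_le_integral => //.
  - by move=> x _; rewrite lee_fin sqr_ge0.
  - exact: measurable_sqr_normc.
  - apply: measurable_funeM; apply: emeasurable_funD; exact: measurable_sqr_normc.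
  move=> x Dx; rewrite -EFinD -EFinM lee_fin.
  have := le x Dx; have := normc_ge0 (h x).
  move: (normc (h x)) (normc (f x)) (normc (g x)) => c a b c0 cab.
  apply: (@le_trans _ _ ((K * (a + b)) ^+ 2)).
    by rewrite ler_pXn2r // nnegrE // (le_trans c0).
  have := mulr_ge0 (sqr_ge0 K) (sqr_ge0 (a - b)); nra.
rewrite ge0_integralZl_EFin //; last 2 first.
- by move=> x _; rewrite -EFinD lee_fin addr_ge0 ?sqr_ge0.
- apply: emeasurable_funD; exact: measurable_sqr_normc.
rewrite ge0_integralD //; last 4 first.
- by move=> x _; rewrite lee_fin sqr_ge0.
- exact: measurable_sqr_normc.
- by move=> x _; rewrite lee_fin sqr_ge0.
- exact: measurable_sqr_normc.
by apply: lte_mul_pinfty => //; rewrite lte_add_pinfty.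
Qed.

Lemma integral_itv_cst (c : R) : (\int[mu]_(x in D) c%:E = (c * l)%:E)%E.
Proof.
rewrite integral_cst // [X in (_ * X)%E](lebesgue_measure_itv `]0, l[) /= lte_fin l_gt0.
by rewrite sube0 -EFinM.
Qed.

Lemma integral_sqr_bounded f (K : R) : cmeasurable D f ->
  (forall x, D x -> normc (f x) <= K) ->
  (\int[mu]_(x in D) (normc (f x) ^+ 2)%:E <= (K ^+ 2 * l)%:E)%E.
Proof.
move=> mf fK; rewrite -integral_itv_cst; apply: ge0_le_integral => //.
- by move=> x _; rewrite lee_fin sqr_ge0.
- exact: measurable_sqr_normc.
move=> x Dx; rewrite lee_fin ler_pXn2r ?nnegrE ?normc_ge0 ?fK //.
by apply: le_trans (fK x Dx); exact: normc_ge0.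
Qed.

Lemma L2_bounded f (K : R) : cmeasurable D f ->
  (forall x, D x -> normc (f x) <= K) -> L2 l f.
Proof.
move=> mf fK; apply/L2P; split => //.
by apply: le_lt_trans (integral_sqr_bounded mf fK) _; rewrite ltry.
Qed.

Lemma L2norm_bounded f (K : R) : cmeasurable D f -> 0 <= K ->
  (forall x, D x -> normc (f x) <= K) -> (L2norm l f <= (K * Num.sqrt l)%:E)%E.
Proof.
move=> mf K0 fK; rewrite L2normE.
have -> : (K * Num.sqrt l)%:E = ((K ^+ 2 * l)%:E `^ 2^-1)%E.
  rewrite poweR_EFin powR12_sqrt; last by rewrite mulr_ge0 ?sqr_ge0 // ltW.
  by rewrite sqrtrM ?sqr_ge0 // sqrtr_sqr ger0_norm.
apply: gt0_ler_poweR; rewrite ?invr_ge0 //.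
- by rewrite in_itv /= leey andbT integral_ge0 // => x _; rewrite lee_fin sqr_ge0.
- by rewrite in_itv /= leey andbT lee_fin mulr_ge0 ?sqr_ge0 ?ltW.
- exact: integral_sqr_bounded.
Qed.

(** Hoelder's inequality with both exponents 2, against the indicator function of the interval,
    whose norm is at most [sqrt l]. *)
Lemma L1_le_L2 f : cmeasurable D f ->
  (\int[mu]_(x in D) (normc (f x))%:E <= L2norm l f * (Num.sqrt l)%:E)%E.
Proof.
move=> mf.
pose F : R -> R := (fun x => normc (f x)) \_ D.
pose G : R -> R := (fun=> 1 : R) \_ D.
have mF : measurable_fun setT F.
  by apply/(measurable_restrictT _ _).1 => //; exact: measurable_normc.
have mG : measurable_fun setT G.
  by apply/(measurable_restrictT _ _).1.
have := hoelder mu mF mG (ltr0n _ 2) (ltr0n _ 2).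
have -> : 2^-1 + 2^-1 = 1 :> R by lra.
move=> /(_ erefl); rewrite Lnorm1.
have E : (\int[mu]_x `|(F x * G x)%:E| = \int[mu]_(x in D) (normc (f x))%:E)%E.
  rewrite [RHS]integral_mkcond; apply: eq_integral => x _ /=.
  rewrite /F /G !patchE; case: ifP => _; first by rewrite mulr1 ger0_norm // normc_ge0.
  by rewrite mulr0 normr0.
rewrite [X in (X <= _)%E](E : _ = _); move=> /le_trans; apply.
rewrite /F /G -!restrict_EFin.
apply: lee_pmul; rewrite ?Lnorm_ge0 //.
have := @L2norm_bounded (fun=> 1) 1.
rewrite mul1r /L2norm ComplexField.Normc.normc1; apply => //.
Qed.

(** Square-integrability is stated on the open interval and the integrals of the formula on closed
    ones; the endpoints have measure zero. *)
Lemma L2_cintegrable f : L2 l f -> cintegrable `[0, l]%classic f.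
Proof.
move=> [mf fy].
have fin : (\int[mu]_(x in D) (normc (f x))%:E < +oo)%E.
  have n0 : (0 <= L2norm l f)%E by rewrite /L2norm Lnorm_ge0.
  apply: le_lt_trans (L1_le_L2 mf) _; apply: lte_mul_pinfty => //.
    by rewrite ge0_fin_numE.
  exact: ltry.
have main (u : R -> R) : measurable_fun D u -> (forall x, `|u x| <= normc (f x)) ->
    mu.-integrable `[0, l]%classic (EFin \o u).
  move=> mu' uf; apply/integrableP; split.
    by apply/measurable_EFinP; exact: measurable_fun_itv_cc mu'.
  rewrite integral_itv_bndoo; last first.
    by apply: measurableT_comp => //; apply/measurable_EFinP.
  apply: le_lt_trans fin; apply: ge0_le_integral => //.
  - by apply: measurableT_comp => //; apply/measurable_EFinP.
  - by apply/measurable_EFinP; exact: measurable_normc.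
  - by move=> x _ /=; rewrite lee_fin.
case: mf => mRe mIm; split; apply: main => // x; first exact: normRe_le.
exact: normIm_le.
Qed.

Lemma integrable_comb (A : set R) (u v : R -> R) (a b : R) : measurable A ->
  mu.-integrable A (EFin \o u) -> mu.-integrable A (EFin \o v) ->
  mu.-integrable A (EFin \o (fun x => a * u x + b * v x)).
Proof.
move=> mA iu iv; have := integrableD _ (integrableZl _ a iu) (integrableZl _ b iv).
by apply.
Qed.

Lemma cintegrable_normc f : cintegrable `[0, l]%classic f ->
  mu.-integrable `[0, l]%classic (EFin \o (fun x => normc (f x))).
Proof.
move=> [iRe iIm].
have I := integrable_comb 1 1 (measurable_itv `[0, l]) (integrable_norm iRe) (integrable_norm iIm).
apply: le_integrable I => //.
  have m1 : measurable_fun `[0, l]%classic (fun x => complex.Re (f x)).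
    by have /integrableP[/measurable_EFinP] := iRe.
  have m2 : measurable_fun `[0, l]%classic (fun x => complex.Im (f x)).
    by have /integrableP[/measurable_EFinP] := iIm.
  by apply/measurable_EFinP; exact: measurable_normc.
move=> x _; rewrite /= !mul1r lee_fin [leLHS]ger0_norm ?normc_ge0 //.
rewrite [leRHS]ger0_norm ?addr_ge0 //; exact: normc_le_ReIm.
Qed.

Lemma integrableM_bounded (u v : R -> R) (M : R) :
  measurable_fun `[0, l]%classic u -> (forall x, 0 <= x <= l -> `|u x| <= M) ->
  mu.-integrable `[0, l]%classic (EFin \o v) ->
  mu.-integrable `[0, l]%classic (EFin \o (fun x => u x * v x)).
Proof.
move=> mu' uM iv.
have bnd : [bounded u x | x in `[0, l]%classic].
  exists M; split; first exact: num_real.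
  move=> N MN x /=; rewrite in_itv /= => xl; apply: le_trans (ltW MN).
  exact: uM.
have := integrableMl _ iv mu' bnd.
have -> : ((EFin \o v) \* (EFin \o u))%E = EFin \o (fun x => u x * v x).
  by apply/funext => x /=; rewrite EFinM muleC.
by apply.
Qed.

Lemma cintegrableM F f : abs_continuous l F -> cintegrable `[0, l]%classic f ->
  cintegrable `[0, l]%classic (fun x => F x * f x).
Proof.
move=> acF [iRe iIm]; have [mRe mIm] := abs_continuous_measurable acF.
have [M M0 FM] := abs_continuous_bounded acF.
have bRe x : 0 <= x <= l -> `|complex.Re (F x)| <= M.
  by move=> /FM; apply: le_trans; exact: normRe_le.
have bIm x : 0 <= x <= l -> `|complex.Im (F x)| <= M.
  by move=> /FM; apply: le_trans; exact: normIm_le.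
split.
  have := integrable_comb 1 (-1) (measurable_itv _)
    (integrableM_bounded mRe bRe iRe) (integrableM_bounded mIm bIm iIm).
  by congr (mu.-integrable _ (EFin \o _)); apply/funext => x; rewrite cReM mul1r mulN1r.
have := integrable_comb 1 1 (measurable_itv _)
  (integrableM_bounded mRe bRe iIm) (integrableM_bounded mIm bIm iRe).
by congr (mu.-integrable _ (EFin \o _)); apply/funext => x; rewrite cImM !mul1r.
Qed.

Lemma cintegrableS (A B : set R) f : measurable A -> measurable B -> A `<=` B ->
  cintegrable B f -> cintegrable A f.
Proof. by move=> mA mB AB [iRe iIm]; split; [move: iRe | move: iIm]; exact: integrableS. Qed.

Lemma cintegrableD (A : set R) f g : measurable A ->
  cintegrable A f -> cintegrable A g -> cintegrable A (fun x => f x + g x).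
Proof.
move=> mA [f1 f2] [g1 g2]; split.
  have := integrable_comb 1 1 mA f1 g1; congr (mu.-integrable _ (EFin \o _)).
  by apply/funext => x; rewrite cReD !mul1r.
have := integrable_comb 1 1 mA f2 g2; congr (mu.-integrable _ (EFin \o _)).
by apply/funext => x; rewrite cImD !mul1r.
Qed.

Lemma cintegrableZ (A : set R) (c : R[i]) f : measurable A ->
  cintegrable A f -> cintegrable A (fun x => c * f x).
Proof.
move=> mA [f1 f2]; split.
  have := integrable_comb (complex.Re c) (- complex.Im c) mA f1 f2.
  congr (mu.-integrable _ (EFin \o _)).
  by apply/funext => x; rewrite cReM mulNr.
have := integrable_comb (complex.Re c) (complex.Im c) mA f2 f1.
congr (mu.-integrable _ (EFin \o _)).
by apply/funext => x; rewrite cImM.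
Qed.

Lemma Rintegral_comb (A : set R) (u v : R -> R) (a b : R) : measurable A ->
  mu.-integrable A (EFin \o u) -> mu.-integrable A (EFin \o v) ->
  \int[mu]_(x in A) (a * u x + b * v x) =
    a * (\int[mu]_(x in A) u x) + b * (\int[mu]_(x in A) v x).
Proof.
move=> mA iu iv; rewrite RintegralD //; first by rewrite !RintegralZl.
  by have := integrableZl _ a iu; apply.
by have := integrableZl _ b iv; apply.
Qed.

Lemma cintegralD (A : set R) f g : measurable A ->
  cintegrable A f -> cintegrable A g ->
  cintegral A (fun x => f x + g x) = cintegral A f + cintegral A g.
Proof.
move=> mA [f1 f2] [g1 g2]; rewrite [LHS]complexE [RHS]complexE.
rewrite cReD cImD /cintegral /=; congr (_%:C + _ * _%:C).
  have := Rintegral_comb 1 1 mA f1 g1; rewrite !mul1r => <-.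
  by apply: eq_Rintegral => x _; rewrite cReD !mul1r.
have := Rintegral_comb 1 1 mA f2 g2; rewrite !mul1r => <-.
by apply: eq_Rintegral => x _; rewrite cImD !mul1r.
Qed.

Lemma cintegralZ (A : set R) (c : R[i]) f : measurable A -> cintegrable A f ->
  cintegral A (fun x => c * f x) = c * cintegral A f.
Proof.
move=> mA [f1 f2]; rewrite (complexE (cintegral A _)) [RHS]complexE.
rewrite cReM cImM /cintegral /=; congr (_%:C + _ * _%:C).
  rewrite -mulNr -Rintegral_comb //.
  by apply: eq_Rintegral => x _; rewrite cReM mulNr.
rewrite -Rintegral_comb //.
by apply: eq_Rintegral => x _; rewrite cImM.
Qed.

Lemma cintegral_itvB f x : cintegrable `[0, l]%classic f -> 0 <= x <= l ->
  cintegral `[x, l]%classic f = cintegral `[0, l]%classic f - cintegral `[0, x]%classic f.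
Proof.
move=> [f1 f2] /andP[x0 xl]; rewrite [LHS]complexE [RHS]complexE.
rewrite cReD cImD cReN cImN /cintegral /=.
have sub : `]x, l]%classic `<=` `[0, l]%classic.
  by move=> t /=; rewrite !in_itv /= => /andP[/ltW xt ->]; rewrite (le_trans x0).
congr (_%:C + _ * _%:C); rewrite Rintegral_itvB ?bnd_simp //.
  by rewrite Rintegral_itv_obnd_cbnd //; apply: integrableS f1.
by rewrite Rintegral_itv_obnd_cbnd //; apply: integrableS f2.
Qed.

(** Real and imaginary parts are each bounded by the integral of the modulus, whence the factor 2;
    it is harmless, as only some bound for the resolvent is required. *)
Lemma normc_cintegral (A : set R) f : measurable A -> cintegrable A f ->
  mu.-integrable A (EFin \o (fun x => normc (f x))) ->
  normc (cintegral A f) <= 2 * \int[mu]_(x in A) normc (f x).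
Proof.
move=> mA [f1 f2] fn; apply: le_trans (normc_le_ReIm _) _.
rewrite mulr2n mulrDl mul1r /=; apply: lerD.
  apply: le_trans (le_normr_Rintegral _ f1) _ => //.
  apply: le_Rintegral => //; first exact: integrable_norm f1.
  by move=> x _; exact: normRe_le.
apply: le_trans (le_normr_Rintegral _ f2) _ => //.
apply: le_Rintegral => //; first exact: integrable_norm f2.
by move=> x _; exact: normIm_le.
Qed.

Lemma normc_cintegralM F f (M x : R) : abs_continuous l F ->
  cintegrable `[0, l]%classic f ->
  (forall t, 0 <= t <= l -> normc (F t) <= M) -> 0 <= x <= l ->
  normc (cintegral `[0, x]%classic (fun t => F t * f t)) <=
    2 * M * \int[mu]_(t in `[0, l]) normc (f t).
Proof.
move=> acF cf FM /andP[x0 xl].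
have M0 : 0 <= M by apply: le_trans (FM 0 _); rewrite ?normc_ge0 // lexx ltW.
have sub : `[0, x]%classic `<=` `[0, l]%classic.
  by move=> t /=; rewrite !in_itv /= => /andP[-> tx] /=; exact: le_trans xl.
have cFf := cintegrableM acF cf.
have nf := cintegrable_normc cf.
have nFfx : mu.-integrable `[0, x]%classic (EFin \o (fun t => normc (F t * f t))).
  by apply: integrableS (cintegrable_normc cFf).
have nfx : mu.-integrable `[0, x]%classic (EFin \o (fun t => normc (f t))).
  by apply: integrableS nf.
have mx : measurable (`[0, x]%classic : set R) by [].
apply: le_trans (normc_cintegral mx _ nFfx) _.
  exact: cintegrableS mx (measurable_itv _) sub cFf.
rewrite -mulrA ler_pM2l // -RintegralZl //.
apply: (@le_trans _ _ (\int[mu]_(t in `[0, x]) (M * normc (f t)))).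
  apply: le_Rintegral => //.
    by have := integrableZl _ M nfx; apply.
  move=> t /sub /=; rewrite in_itv /= => tl.
  by rewrite ComplexField.Normc.normcM ler_wpM2r ?normc_ge0 ?FM.
rewrite !RintegralZl // ler_wpM2l // -subr_ge0.
rewrite Rintegral_itvB ?bnd_simp //.
by apply: Rintegral_ge0 => t _; exact: normc_ge0.
Qed.

Lemma Rintegral_normc_le f : L2 l f ->
  ((\int[mu]_(t in `[0, l]) normc (f t))%:E <= L2norm l f * (Num.sqrt l)%:E)%E.
Proof.
move=> L2f; have [mf _] := L2f; apply: le_trans (L1_le_L2 mf).
have nf := cintegrable_normc (L2_cintegrable L2f).
rewrite /Rintegral fineK; last exact: integrable_fin_num nf.
by rewrite integral_itv_bndoo //; apply/measurable_EFinP; exact: measurable_normc.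
Qed.

End Lebesgue.

(** * Solutions of the differential equation *)

Section ComplexDerivative.
Variable R : realType.
Implicit Types (F G : R -> R[i]) (x : R) (d e : R[i]).

Lemma cderive_eq F x d e : cderive F x d -> d = e -> cderive F x e.
Proof. by move=> dF <-. Qed.

Lemma cderive_cst (c : R[i]) x : cderive (fun=> c) x 0.
Proof. by split; exact: is_derive_cst. Qed.

Lemma cderiveD F G x d e : cderive F x d -> cderive G x e ->
  cderive (fun t => F t + G t) x (d + e).
Proof.
move=> [dF1 dF2] [dG1 dG2]; split.
  rewrite cReD (_ : (fun t => _) = (fun t => complex.Re (F t)) +
    (fun t => complex.Re (G t))); last by apply/funext => t; rewrite cReD.
  exact: is_deriveD.
rewrite cImD (_ : (fun t => _) = (fun t => complex.Im (F t)) +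
  (fun t => complex.Im (G t))); last by apply/funext => t; rewrite cImD.
exact: is_deriveD.
Qed.

Lemma cderiveM F G x d e : cderive F x d -> cderive G x e ->
  cderive (fun t => F t * G t) x (d * G x + F x * e).
Proof.
move=> [dF1 dF2] [dG1 dG2]; split.
  rewrite (_ : (fun t => _) = (fun t => complex.Re (F t)) * (fun t => complex.Re (G t))
    - (fun t => complex.Im (F t)) * (fun t => complex.Im (G t))); last first.
    by apply/funext => t; rewrite cReM.
  apply: is_derive_eq (is_deriveB (is_deriveM dF1 dG1) (is_deriveM dF2 dG2)) _.
  rewrite cReD !cReM /GRing.scale /=; ring.
rewrite (_ : (fun t => _) = (fun t => complex.Re (F t)) * (fun t => complex.Im (G t))
  + (fun t => complex.Im (F t)) * (fun t => complex.Re (G t))); last first.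
  by apply/funext => t; rewrite cImM.
apply: is_derive_eq (is_deriveD (is_deriveM dF1 dG2) (is_deriveM dF2 dG1)) _.
rewrite cImD !cImM /GRing.scale /=; ring.
Qed.

Lemma cderiveN F x d : cderive F x d -> cderive (fun t => - F t) x (- d).
Proof.
move=> dF; have := cderiveM (cderive_cst (-1) x) dF.
rewrite mul0r add0r mulN1r; congr cderive; apply/funext => t.
by rewrite mulN1r.
Qed.

Lemma cderive_conj F x d : cderive F x d ->
  cderive (fun t => conjc (F t)) x (conjc d).
Proof.
move=> [dF1 dF2]; split.
  rewrite (_ : complex.Re (conjc d) = complex.Re d); last by case: (d).
  rewrite (_ : (fun t => _) = fun t => complex.Re (F t)) //.
  by apply/funext => t; case: (F t).
rewrite (_ : complex.Im (conjc d) = - complex.Im d); last by case: (d).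
rewrite (_ : (fun t => _) = - (fun t => complex.Im (F t))); first exact: is_deriveN.
apply/funext => t; transitivity (- complex.Im (F t)); last by [].
by case: (F t).
Qed.

End ComplexDerivative.

Ltac cderive_tac := repeat lazymatch goal with
  | |- cderive (fun t => @?F t + @?G t) _ _ => refine (cderiveD (F := F) (G := G) _ _)
  | |- cderive (fun t => - @?F t) _ _ => refine (cderiveN (F := F) _)
  | |- cderive (fun t => @?F t * @?G t) _ _ => refine (cderiveM (F := F) (G := G) _ _)
  | |- _ => first [eassumption | exact: cderive_cst]
  end.

Ltac abs_continuous_tac := repeat lazymatch goal with
  | |- abs_continuous _ (fun t => @?F t + @?G t) =>
      refine (abs_continuousD (F := F) (G := G) _ _)
  | |- abs_continuous _ (fun t => - @?F t) => refine (abs_continuousN (F := F) _)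
  | |- abs_continuous _ (fun t => @?F t * @?G t) =>
      refine (abs_continuousM (F := F) (G := G) _ _)
  | |- _ => solve [exact: abs_continuous_cst | assumption | match goal with
      | H : forall p, _ -> abs_continuous _ _ |- _ => by apply H
      | H : forall p k, _ -> _ -> abs_continuous _ _ |- _ => by apply H
      end]
  end.

Section AlmostEverywhere.
Variable R : realType.
Local Notation mu := (@lebesgue_measure R).
Implicit Types P Q : R -> Prop.

Lemma ae_mono P Q : (forall x, P x -> Q x) ->
  {ae mu, forall x, P x} -> {ae mu, forall x, Q x}.
Proof. by move=> PQ; apply: filterS => //; exact: (ae_filter_ringOfSetsType mu). Qed.

Lemma ae_and P Q : {ae mu, forall x, P x} -> {ae mu, forall x, Q x} ->
  {ae mu, forall x, P x /\ Q x}.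
Proof. by apply: filterS2 => //; exact: (ae_filter_ringOfSetsType mu). Qed.

End AlmostEverywhere.

(** * Lagrange form and Wronskian *)

Section Jets.
Variables (R : realType) (l : R).
Hypothesis l_gt0 : 0 < l.
Local Notation mu := (@lebesgue_measure R).
Implicit Types (Y V : nat -> R -> R[i]) (S : nat -> nat -> R -> R[i]).

(** Normalized form of the equation: [c = -i (z - q)] encodes i y''' + q y = z y, and [- c] the
    formal adjoint equation. *)
Definition jet_solution (c : R -> R[i]) Y : Prop :=
  ac_jet3 l Y /\ {ae mu, forall x, x \in `]0, l[ -> Y 3%N x = c x * Y 0%N x}.

Lemma ac_jet3_abs_continuous Y k : ac_jet3 l Y -> (k < 3)%N -> abs_continuous l (Y k).
Proof. by move=> jY k3; have [] := jY k k3. Qed.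

Lemma ac_jet3_cderive Y : ac_jet3 l Y -> {ae mu, forall x, x \in `]0, l[ ->
  [/\ cderive (Y 0%N) x (Y 1%N x), cderive (Y 1%N) x (Y 2%N x) &
      cderive (Y 2%N) x (Y 3%N x)]}.
Proof.
move=> jY; have [_ d0] := jY 0%N isT; have [_ d1] := jY 1%N isT.
have [_ d2] := jY 2%N isT.
by apply: ae_mono (ae_and d0 (ae_and d1 d2)) => x [h0 [h1 h2]] xl; split; auto.
Qed.

(** In the derivative all terms telescope except Y''' V + Y V''', and these cancel because the two
    coefficients are opposite. *)
Lemma lagrange_identity (c : R -> R[i]) Y V :
  jet_solution c Y -> jet_solution (fun x => - c x) V ->
  forall x, 0 <= x <= l ->
    Y 2%N x * V 0%N x - Y 1%N x * V 1%N x + Y 0%N x * V 2%N x =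
    Y 2%N 0 * V 0%N 0 - Y 1%N 0 * V 1%N 0 + Y 0%N 0 * V 2%N 0.
Proof.
move=> [jY eY] [jV eV].
have acY k := ac_jet3_abs_continuous jY (k := k).
have acV k := ac_jet3_abs_continuous jV (k := k).
apply: (@abs_continuous_derive0 _ l
  (fun x => Y 2%N x * V 0%N x - Y 1%N x * V 1%N x + Y 0%N x * V 2%N x)) => //.
  by abs_continuous_tac.
apply: ae_mono (ae_and (ae_and (ac_jet3_cderive jY) eY) (ae_and (ac_jet3_cderive jV) eV)).
move=> x [[dY {}eY] [dV {}eV]] xl.
have [d0 d1 d2] := dY xl; have [e0 e1 e2] := dV xl.
by apply: cderive_eq; [cderive_tac | rewrite eY // eV //; ring].
Qed.

Definition wronskian S x :=
  S 0%N 0%N x * (S 1%N 1%N x * S 2%N 2%N x - S 1%N 2%N x * S 2%N 1%N x)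
  - S 0%N 1%N x * (S 1%N 0%N x * S 2%N 2%N x - S 1%N 2%N x * S 2%N 0%N x)
  + S 0%N 2%N x * (S 1%N 0%N x * S 2%N 1%N x - S 1%N 1%N x * S 2%N 0%N x).

(** Differentiating one column of the determinant produces either a repeated column or, for the last
    one, [c] times the first. This is Liouville's formula for an equation without second-order
    term. *)
Lemma wronskian_cst (c : R -> R[i]) S :
  (forall p, (p < 3)%N -> jet_solution c (S p)) ->
  forall x, 0 <= x <= l -> wronskian S x = wronskian S 0.
Proof.
move=> solS; have [j0 e0] := solS 0%N isT; have [j1 e1] := solS 1%N isT.
have [j2 e2] := solS 2%N isT.
have ac p k : (p < 3)%N -> (k < 3)%N -> abs_continuous l (S p k).
  by move=> p3 k3; have [jp _] := solS p p3; exact: ac_jet3_abs_continuous.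
apply: abs_continuous_derive0 => //.
  by rewrite /wronskian; abs_continuous_tac.
have d0 := ac_jet3_cderive j0; have d1 := ac_jet3_cderive j1.
have d2 := ac_jet3_cderive j2.
apply: ae_mono (ae_and (ae_and d0 (ae_and d1 d2)) (ae_and e0 (ae_and e1 e2))).
move=> x [[{}d0 [{}d1 {}d2]] [{}e0 [{}e1 {}e2]]] xl.
have [d00 d01 d02] := d0 xl; have [d10 d11 d12] := d1 xl.
have [d20 d21 d22] := d2 xl.
rewrite /wronskian; apply: cderive_eq; first by cderive_tac.
by rewrite e0 // e1 // e2 //; ring.
Qed.

Lemma ac_jet3B Y V : ac_jet3 l Y -> ac_jet3 l V ->
  ac_jet3 l (fun k x => Y k x - V k x).
Proof.
move=> jY jV k k3; have [acY dY] := jY k k3; have [acV dV] := jV k k3; split.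
  by abs_continuous_tac.
apply: ae_mono (ae_and dY dV) => x [{}dY {}dV] xl.
by apply: cderiveD; [exact: dY | apply: cderiveN; exact: dV].
Qed.

Lemma jet_solutionB (c : R -> R[i]) Y V : jet_solution c Y -> jet_solution c V ->
  jet_solution c (fun k x => Y k x - V k x).
Proof.
move=> [jY eY] [jV eV]; split; first exact: ac_jet3B.
by apply: ae_mono (ae_and eY eV) => x [e e'] xl; rewrite e // e' // mulrBr.
Qed.

Lemma jet_solutionZ (c : R -> R[i]) (a : R[i]) Y : jet_solution c Y ->
  jet_solution c (fun k x => a * Y k x).
Proof.
move=> [jY eY]; split.
  move=> k k3; have [acY dY] := jY k k3; split; first by abs_continuous_tac.
  apply: ae_mono dY => x dY xl; have {}dY := dY xl.
  by apply: cderive_eq; [cderive_tac | rewrite mul0r add0r].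
by apply: ae_mono eY => x e xl; rewrite e // mulrCA.
Qed.

(** * Fundamental systems of the equation and of its adjoint *)

Section FundamentalSystem.
Variables (c : R -> R[i]) (S V : nat -> nat -> R -> R[i]).
Hypothesis solS : forall p, (p < 3)%N -> jet_solution c (S p).
Hypothesis solV : forall p, (p < 3)%N -> jet_solution (fun x => - c x) (V p).
Hypothesis S0 : forall p j, (p < 3)%N -> (j < 3)%N -> S p j 0 = (p == j)%:R.
Hypothesis V0 : forall p j, (p < 3)%N -> (j < 3)%N -> V p j 0 = (p == j)%:R.

Lemma wronskian1 x : 0 <= x <= l -> wronskian S x = 1.
Proof.
move=> xl; rewrite (wronskian_cst solS) // /wronskian !S0 //=; ring.
Qed.

Lemma wronskian_adj1 x : 0 <= x <= l -> wronskian V x = 1.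
Proof.
move=> xl; rewrite (wronskian_cst solV) // /wronskian !V0 //=; ring.
Qed.

(** The pairing matrix keeps its value at 0: it is antidiagonal with entries 1, -1, 1, the sign
    pattern that reappears in the kernel [G]. *)
Lemma fundamental_pairing p r x : (p < 3)%N -> (r < 3)%N -> 0 <= x <= l ->
  S p 2%N x * V r 0%N x - S p 1%N x * V r 1%N x + S p 0%N x * V r 2%N x =
  (p == 2%N)%:R * (r == 0%N)%:R - (p == 1%N)%:R * (r == 1%N)%:R
    + (p == 0%N)%:R * (r == 2%N)%:R.
Proof.
by move=> p3 r3 xl; rewrite (lagrange_identity (solS p3) (solV r3)) // !S0 // !V0.
Qed.

(* Cramer's rule for the adjoint solution [V r], from its pairings with the
   fundamental system and [wronskian S = 1]. *)
Lemma adjoint_cofactor x : 0 <= x <= l ->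
  [/\ V 0%N 0%N x = S 0%N 0%N x * S 1%N 1%N x - S 0%N 1%N x * S 1%N 0%N x,
      V 1%N 0%N x = S 0%N 0%N x * S 2%N 1%N x - S 0%N 1%N x * S 2%N 0%N x &
      V 2%N 0%N x = S 1%N 0%N x * S 2%N 1%N x - S 1%N 1%N x * S 2%N 0%N x].
Proof.
move=> xl; have W := wronskian1 xl.
have E r : (r < 3)%N -> V r 0%N x =
  (r == 0%N)%:R * (S 0%N 0%N x * S 1%N 1%N x - S 0%N 1%N x * S 1%N 0%N x)
  + (r == 1%N)%:R * (S 0%N 0%N x * S 2%N 1%N x - S 0%N 1%N x * S 2%N 0%N x)
  + (r == 2%N)%:R * (S 1%N 0%N x * S 2%N 1%N x - S 1%N 1%N x * S 2%N 0%N x).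
  move=> r3; have := fundamental_pairing (p := 0%N) isT r3 xl.
  have := fundamental_pairing (p := 1%N) isT r3 xl.
  have := fundamental_pairing (p := 2%N) isT r3 xl.
  rewrite /= !mul0r !mul1r !subr0 !sub0r !addr0 !add0r => e2 e1 e0.
  transitivity (wronskian S x * V r 0%N x); first by rewrite W mul1r.
  rewrite -e0 -[in RHS]e2 -[(r == 1%N)%:R]opprK -e1 /wronskian.
  by ring.
by rewrite !E //=; split; ring.
Qed.

(** The difference [D] of the two sides has zero data at 0, so its pairings with the three adjoint
    solutions vanish everywhere. They form a linear system for [D] and its derivatives, which is
    nonsingular because the Wronskian of [V] is 1. *)
Lemma solution_expand Y k x : jet_solution c Y -> (k < 3)%N -> 0 <= x <= l ->
  Y k x = Y 0%N 0 * S 0%N k x + Y 1%N 0 * S 1%N k x + Y 2%N 0 * S 2%N k x.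
Proof.
move=> solY k3 xl.
pose D j t := Y j t - Y 0%N 0 * S 0%N j t - Y 1%N 0 * S 1%N j t - Y 2%N 0 * S 2%N j t.
have solD : jet_solution c D.
  by do 3 (apply: jet_solutionB; last by apply: jet_solutionZ; exact: solS).
have D0 j : (j < 3)%N -> D j 0 = 0.
  by case: j => [|[|[|//]]] _; rewrite /D !S0 //=; ring.
have P r : (r < 3)%N ->
    D 2%N x * V r 0%N x - D 1%N x * V r 1%N x + D 0%N x * V r 2%N x = 0.
  by move=> r3; rewrite (lagrange_identity solD (solV r3)) // !D0 //; ring.
have W := wronskian_adj1 xl.
have e0 := P 0%N isT; have e1 := P 1%N isT; have e2 := P 2%N isT.
suff : D k x = 0.
  rewrite /D => /eqP; rewrite -!addrA addr_eq0 => /eqP ->; ring.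
rewrite -[LHS]mul1r -W /wronskian.
case: k k3 => [|[|[|//]]] _.
(* Cramer's rule: [D k] times the Wronskian of [V] is the combination of the three pairings whose
   coefficients are 2x2 minors of [V], chosen to eliminate the other two derivatives of [D]. *)
- transitivity (
  (V 0%N 0%N x * V 1%N 1%N x - V 0%N 1%N x * V 1%N 0%N x)
   * (D 2%N x * V 2%N 0%N x - D 1%N x * V 2%N 1%N x + D 0%N x * V 2%N 2%N x)
  - (V 0%N 0%N x * V 2%N 1%N x - V 0%N 1%N x * V 2%N 0%N x)
   * (D 2%N x * V 1%N 0%N x - D 1%N x * V 1%N 1%N x + D 0%N x * V 1%N 2%N x)
  + (V 1%N 0%N x * V 2%N 1%N x - V 1%N 1%N x * V 2%N 0%N x)
   * (D 2%N x * V 0%N 0%N x - D 1%N x * V 0%N 1%N x + D 0%N x * V 0%N 2%N x)).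
    by ring.
  by rewrite e0 e1 e2; ring.
- transitivity (
  (V 0%N 0%N x * V 1%N 2%N x - V 0%N 2%N x * V 1%N 0%N x)
   * (D 2%N x * V 2%N 0%N x - D 1%N x * V 2%N 1%N x + D 0%N x * V 2%N 2%N x)
  - (V 0%N 0%N x * V 2%N 2%N x - V 0%N 2%N x * V 2%N 0%N x)
   * (D 2%N x * V 1%N 0%N x - D 1%N x * V 1%N 1%N x + D 0%N x * V 1%N 2%N x)
  + (V 1%N 0%N x * V 2%N 2%N x - V 1%N 2%N x * V 2%N 0%N x)
   * (D 2%N x * V 0%N 0%N x - D 1%N x * V 0%N 1%N x + D 0%N x * V 0%N 2%N x)).
    by ring.
  by rewrite e0 e1 e2; ring.
- transitivity (
  (V 0%N 1%N x * V 1%N 2%N x - V 0%N 2%N x * V 1%N 1%N x)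
   * (D 2%N x * V 2%N 0%N x - D 1%N x * V 2%N 1%N x + D 0%N x * V 2%N 2%N x)
  - (V 0%N 1%N x * V 2%N 2%N x - V 0%N 2%N x * V 2%N 1%N x)
   * (D 2%N x * V 1%N 0%N x - D 1%N x * V 1%N 1%N x + D 0%N x * V 1%N 2%N x)
  + (V 1%N 1%N x * V 2%N 2%N x - V 1%N 2%N x * V 2%N 1%N x)
   * (D 2%N x * V 0%N 0%N x - D 1%N x * V 0%N 1%N x + D 0%N x * V 0%N 2%N x)).
    by ring.
  by rewrite e0 e1 e2; ring.
Qed.

End FundamentalSystem.
End Jets.

Lemma jet_solution_conj (R : realType) (l : R) (c : R -> R[i]) Y : jet_solution l c Y ->
  jet_solution l (fun x => conjc (c x)) (fun k x => conjc (Y k x)).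
Proof.
move=> [jY eY]; split.
  move=> k k3; have [acY dY] := jY k k3; split; first exact: abs_continuous_conj.
  by apply: ae_mono dY => x dY xl; apply: cderive_conj; exact: dY.
by apply: ae_mono eY => x e xl; rewrite e // rmorphM.
Qed.

(** * The resolvent *)

Section Combinations.
Variable R : realType.

Lemma eq_cintegral (A : set R) (f g : R -> R[i]) : (forall x, A x -> f x = g x) ->
  cintegral A f = cintegral A g.
Proof.
move=> fg; rewrite /cintegral; congr Complex;
  by apply: eq_Rintegral => x /set_mem /fg ->.
Qed.

(** The kernels of the resolvent formula are, in [t], combinations of three fixed functions; this
    turns every integral of the formula into a combination of three moments of [f]. *)
Lemma cintegral_comb3 (A : set R) (v : nat -> R -> R[i]) (f : R -> R[i])
    (a0 a1 a2 : R[i]) : measurable A ->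
  (forall p, (p < 3)%N -> cintegrable A (fun t => v p t * f t)) ->
  cintegral A (fun t => (a0 * v 0%N t + a1 * v 1%N t + a2 * v 2%N t) * f t) =
    a0 * cintegral A (fun t => v 0%N t * f t)
    + a1 * cintegral A (fun t => v 1%N t * f t)
    + a2 * cintegral A (fun t => v 2%N t * f t).
Proof.
move=> mA iv; rewrite -!cintegralZ //; try exact: iv.
have iZ a p : (p < 3)%N -> cintegrable A (fun t => a * (v p t * f t)).
  by move=> p3; apply: cintegrableZ => //; exact: iv.
rewrite -!cintegralD //; try exact: iZ; last by apply: cintegrableD => //; exact: iZ.
by apply: eq_cintegral => t _; ring.
Qed.

Lemma normcM_le (x y : R[i]) (a b : R) : normc x <= a -> normc y <= b ->
  normc (x * y) <= a * b.
Proof.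
by move=> xa yb; rewrite ComplexField.Normc.normcM ler_pM // normc_ge0.
Qed.

Lemma normcD_le (x y : R[i]) (a b : R) : normc x <= a -> normc y <= b ->
  normc (x + y) <= a + b.
Proof. by move=> xa yb; apply: le_trans (normcD x y) _; exact: lerD. Qed.

Lemma normcN_le (x : R[i]) (a : R) : normc x <= a -> normc (- x) <= a.
Proof. by rewrite normcN. Qed.

End Combinations.

Ltac normc_tac := repeat first
  [ eassumption | apply: normcD_le | apply: normcN_le | apply: normcM_le ].

Lemma normci (R : realType) : normc ('i%C : R[i]) = 1.
Proof. by rewrite /= expr0n expr1n add0r sqrtr1. Qed.

Lemma mulii (R : realType) : 'i%C * 'i%C = -1 :> R[i].
Proof. by rewrite -expr2 sqr_i. Qed.

(** * The boundary value problem: solution, bound and uniqueness *)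

Section Resolvent.
Variables (R : realType) (l : R) (q : R -> R) (theta z : R[i]).
Variables S V : nat -> nat -> R -> R[i].
Hypothesis l_gt0 : 0 < l.
Hypothesis q_L2 : L2 l (fun x => (q x)%:C).
Local Notation mu := (@lebesgue_measure R).
Let c (x : R) : R[i] := - 'i%C * (z - (q x)%:C).
Hypothesis solS : forall p, (p < 3)%N -> jet_solution l c (S p).
Hypothesis solV : forall p, (p < 3)%N -> jet_solution l (fun x => - c x) (V p).
Hypothesis S0 : forall p j, (p < 3)%N -> (j < 3)%N -> S p j 0 = (p == j)%:R.
Hypothesis V0 : forall p j, (p < 3)%N -> (j < 3)%N -> V p j 0 = (p == j)%:R.
Let delta := - (theta * S 2%N 0%N l + V 2%N 0%N l).
Hypothesis delta_neq0 : delta != 0.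

Definition green (x t : R) : R[i] :=
  S 0%N 0%N x * V 2%N 0%N t - S 1%N 0%N x * V 1%N 0%N t + S 2%N 0%N x * V 0%N 0%N t.

Definition green_resolvent (f : R -> R[i]) (x : R) : R[i] :=
  'i%C / delta *
    (cintegral `[0, l]%classic (fun t =>
       (green x l * V 2%N 0%N t - theta * green l t * S 2%N 0%N x) * f t)
     + theta * cintegral `[0, x]%classic (fun t => green x t * S 2%N 0%N l * f t)
     - cintegral `[x, l]%classic (fun t => green x t * V 2%N 0%N l * f t)).

Definition moment (f : R -> R[i]) (p : nat) (x : R) : R[i] :=
  cintegral `[0, x]%classic (fun t => V p 0%N t * f t).

Definition shift1 (f : R -> R[i]) : R[i] := 'i%C / delta *
  (V 2%N 0%N l * moment f 1 l - V 1%N 0%N l * moment f 2 l).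

Definition shift2 (f : R -> R[i]) : R[i] := 'i%C / delta *
  (V 0%N 0%N l * moment f 2 l
   - theta * (S 0%N 0%N l * moment f 2 l - S 1%N 0%N l * moment f 1 l
              + S 2%N 0%N l * moment f 0 l)
   - V 2%N 0%N l * moment f 0 l).

(* Variation of constants: the coefficients of the fundamental system are
   [-i I_2], [i I_1 + shift1], [-i I_0 + shift2], with [I_p] the integral of
   [V p 0 * f]; the shifts are dictated by the boundary conditions at [l]. *)
Definition variation (I : nat -> R -> R[i]) (a b : R[i]) (k : nat) (x : R) : R[i] :=
  - 'i%C * I 2%N x * S 0%N k x + ('i%C * I 1%N x + a) * S 1%N k x
  + (- 'i%C * I 0%N x + b) * S 2%N k x.

Lemma ac_S p k : (p < 3)%N -> (k < 3)%N -> abs_continuous l (S p k).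
Proof. by move=> p3 k3; have [jp _] := solS p3; exact: ac_jet3_abs_continuous. Qed.

Lemma ac_V p k : (p < 3)%N -> (k < 3)%N -> abs_continuous l (V p k).
Proof. by move=> p3 k3; have [jp _] := solV p3; exact: ac_jet3_abs_continuous. Qed.

(** Write the integral over [[x, l]] as a difference of integrals from 0. The factor of the integral
    over [[0, x]] becomes [theta * S 2 0 l + V 2 0 l = - delta], which leaves -i times the integral
    of [green x t * f t]. In the remaining integrals over [[0, l]] the multiples of [S 0 0 x]
    cancel, and those of [S 1 0 x] and [S 2 0 x] are the two shifts. *)
Lemma green_resolventE f x : L2 l f -> 0 <= x <= l ->
  green_resolvent f x = variation (moment f) (shift1 f) (shift2 f) 0%N x.
Proof.
move=> /(L2_cintegrable l_gt0) cf xl.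
have cl p : (p < 3)%N -> cintegrable `[0, l]%classic (fun t => V p 0%N t * f t).
  by move=> p3; apply: cintegrableM => //; exact: ac_V.
have /andP[x0 xl'] := xl.
have sub0 : `[0, x]%classic `<=` `[0, l]%classic.
  by move=> t /=; rewrite !in_itv /= => /andP[-> tx] /=; exact: le_trans xl'.
have mx : measurable (`[0, x]%classic : set R) by [].
have ml : measurable (`[0, l]%classic : set R) by [].
have cx p : (p < 3)%N -> cintegrable `[0, x]%classic (fun t => V p 0%N t * f t).
  by move=> p3; apply: cintegrableS mx ml sub0 _; exact: cl.
have cG a : cintegrable `[0, l]%classic (fun t => green x t * a * f t).
  apply: (cintegrableM (F := fun t => green x t * a)) => //.
  have acV p : (p < 3)%N -> abs_continuous l (V p 0%N) by move=> p3; exact: ac_V.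
  by rewrite /green; abs_continuous_tac.
rewrite /green_resolvent (cintegral_itvB (cG _) xl).
have E A a : measurable A -> (forall p, (p < 3)%N ->
      cintegrable A (fun t => V p 0%N t * f t)) ->
    cintegral A (fun t => green x t * a * f t) =
    S 2%N 0%N x * a * cintegral A (fun t => V 0%N 0%N t * f t)
    - S 1%N 0%N x * a * cintegral A (fun t => V 1%N 0%N t * f t)
    + S 0%N 0%N x * a * cintegral A (fun t => V 2%N 0%N t * f t).
  move=> mA cA; rewrite -mulNr -(cintegral_comb3 (v := fun p => V p 0%N)) //.
  by apply: eq_cintegral => t _; rewrite /green; ring.
have -> : cintegral `[0, l]%classic (fun t =>
       (green x l * V 2%N 0%N t - theta * green l t * S 2%N 0%N x) * f t) =
    - (theta * S 2%N 0%N l * S 2%N 0%N x) * moment f 0 l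
    + theta * S 1%N 0%N l * S 2%N 0%N x * moment f 1 l
    + (green x l - theta * S 0%N 0%N l * S 2%N 0%N x) * moment f 2 l.
  rewrite -(cintegral_comb3 (v := fun p => V p 0%N)) //.
  by apply: eq_cintegral => t _; rewrite /green; ring.
rewrite !E // /variation /shift1 /shift2 -!/(moment _ _ _) /green.
by move: delta_neq0; rewrite /delta oppr_eq0 => h; field.
Qed.

(** Once the adjoint values at [l] are replaced by cofactors, the conditions at [l] are rational
    identities with denominator [delta] in the values of [S] at [l] and the moments. *)
Lemma variation_boundary f : let U := variation (moment f) (shift1 f) (shift2 f) in
  moment f 0 0 = 0 -> moment f 1 0 = 0 -> moment f 2 0 = 0 ->
  [/\ U 0%N 0 = 0, U 1%N l = theta * U 1%N 0 & U 0%N l = 0].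
Proof.
move=> U p0 p1 p2; have ll : 0 <= l <= l by rewrite lexx ltW.
have [E0 E1 E2] := adjoint_cofactor l_gt0 solS solV S0 V0 ll.
have W := wronskian1 l_gt0 solS S0 ll.
move: delta_neq0; rewrite /U /variation /shift1 /shift2 p0 p1 p2 !S0 //= /delta oppr_eq0.
rewrite E0 E1 E2 => h; split.
- by ring.
- by field.
- by field.
Qed.

Lemma moment0 f p : moment f p 0 = 0.
Proof.
rewrite /moment /cintegral set_itv1 !Rintegral_set1; exact: erefl.
Qed.

Lemma resolvent_jet f : L2 l f -> exists U : nat -> R -> R[i],
  [/\ W23_jet l U,
     [/\ U 0%N 0 = 0, U 1%N l = theta * U 1%N 0 & U 0%N l = 0],
     {ae mu, forall x, x \in `]0, l[ ->
        U 3%N x = - 'i%C * f x + c x * U 0%N x} &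
     forall x, 0 <= x <= l -> U 0%N x = green_resolvent f x].
Proof.
move=> L2f; have cf := L2_cintegrable l_gt0 L2f.
have prim p : exists F : R -> R[i], (p < 3)%N -> [/\ abs_continuous l F,
    forall x, 0 <= x <= l -> F x = moment f p x &
    {ae mu, forall x, x \in `]0, l[ -> cderive F x (V p 0%N x * f x)}].
  have [p3|_] := boolP (p < 3)%N; last by exists (fun=> 0).
  have [F HF] := primitive_exists (cintegrableM (ac_V p3 (ltn0Sn 2)) cf).
  by exists F.
have {prim}[I HI] := choice prim.
have acI p : (p < 3)%N -> abs_continuous l (I p) by move=> /HI[].
have II p x : (p < 3)%N -> 0 <= x <= l -> I p x = moment f p x.
  by move=> /HI[_ + _] xl; apply.
have acS p k : (p < 3)%N -> (k < 3)%N -> abs_continuous l (S p k) by exact: ac_S.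
pose U k := variation I (shift1 f) (shift2 f) k.
(* The third component is defined as the right-hand side of the equation, so the equation holds by
   definition and the work is to show that it is the derivative of [U 2] almost everywhere. *)
pose U' k x := if k == 3%N then - 'i%C * f x + c x * U 0%N x else U k x.
have acU k : (k < 3)%N -> abs_continuous l (U k).
  by move=> k3; rewrite /U /variation; abs_continuous_tac.
have UE k x : (k < 3)%N -> 0 <= x <= l ->
    U k x = variation (moment f) (shift1 f) (shift2 f) k x.
  by move=> k3 xl; rewrite /U /variation !II.
have ll : 0 <= l <= l by rewrite lexx ltW.
have l0 : 0 <= (0 : R) <= l by rewrite lexx ltW.
have sub : `]0, l[%classic `<=` `[0, l]%classic by exact: subset_itv_oo_cc.
have mU0 : cmeasurable `]0, l[%classic (U 0%N).
  by apply: cmeasurableS sub _ => //; exact: abs_continuous_measurable (acU 0%N isT).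
have [M M0 UM] := abs_continuous_bounded (acU 0%N isT).
exists U'; split.
- split.
    move=> k k3; have Uk : U' k = U k by rewrite /U'; case: k k3 => [|[|[|]]].
    rewrite Uk; split; first exact: acU.
    have [d0 _] := solS (p := 0%N) isT; have [d1 _] := solS (p := 1%N) isT.
    have [d2 _] := solS (p := 2%N) isT.
    have {}d0 := ac_jet3_cderive d0; have {}d1 := ac_jet3_cderive d1.
    have {}d2 := ac_jet3_cderive d2.
    have [_ e0] := solS (p := 0%N) isT; have [_ e1] := solS (p := 1%N) isT.
    have [_ e2] := solS (p := 2%N) isT.
    have [_ _ i0] := HI 0%N isT; have [_ _ i1] := HI 1%N isT.
    have [_ _ i2] := HI 2%N isT.
    apply: ae_mono (ae_and (ae_and (ae_and d0 (ae_and d1 d2)) (ae_and e0 (ae_and e1 e2)))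
      (ae_and i0 (ae_and i1 i2))).
    move=> x [[[{}d0 [{}d1 {}d2]] [{}e0 [{}e1 {}e2]]] [{}i0 [{}i1 {}i2]]] xl.
    have {d0}[d00 d01 d02] := d0 xl; have {d1}[d10 d11 d12] := d1 xl.
    have {d2}[d20 d21 d22] := d2 xl.
    have {}i0 := i0 xl; have {}i1 := i1 xl; have {}i2 := i2 xl.
    have {}e0 := e0 xl; have {}e1 := e1 xl; have {}e2 := e2 xl.
    have xl' : 0 <= x <= l by apply: sub.
    have [E0 E1 E2] := adjoint_cofactor l_gt0 solS solV S0 V0 xl'.
    have W := wronskian1 l_gt0 solS S0 xl'.
    rewrite /U' /U /variation; case: k k3 {Uk} => [|[|[|//]]] _ /=.
    + by apply: cderive_eq; [cderive_tac | rewrite E0 E1 E2; ring].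
    + by apply: cderive_eq; [cderive_tac | rewrite E0 E1 E2; ring].
    + apply: cderive_eq; first by cderive_tac.
      (* Here the derivatives of the coefficients do not cancel: they contribute -i [f x] times the
         Wronskian, which is why the expected term is multiplied by it. *)
      rewrite e0 e1 e2 E0 E1 E2 -[- 'i%C * f x]mulr1 -W /wronskian; ring.
  have mq : cmeasurable `]0, l[%classic c.
    have [mq _] := q_L2; apply: cmeasurableM; first exact: cmeasurable_cst.
    apply: cmeasurable_eq (cmeasurableD (cmeasurable_cst _ z)
      (cmeasurableM (cmeasurable_cst _ (-1)) mq)) => x _.
    by rewrite mulN1r.
  have L2c : L2 l c.
    apply: (L2_dominated (K := 1) mq _ q_L2).
      by apply: (L2_bounded l_gt0 (cmeasurable_cst _ z)) => x _; exact: lexx.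
    move=> x _; rewrite /c ComplexField.Normc.normcM normcN normci !mul1r.
    by apply: le_trans (normcD _ _) _; rewrite normcN.
  have [mf _] := L2f.
  (* With [M] a bound for [U 0], the third component is at most [|f| + M |c|]. *)
  apply: (L2_dominated (K := 1 + M) _ L2f L2c).
    rewrite /U' /=; apply: cmeasurableD; last exact: cmeasurableM.
    by apply: cmeasurableM => //; exact: cmeasurable_cst.
  move=> x /sub /= xl; rewrite /U' /=; apply: le_trans (normcD _ _) _.
  rewrite (ComplexField.Normc.normcM (- 'i%C)) (ComplexField.Normc.normcM (c x)).
  rewrite normcN normci mul1r.
  have := UM x xl; have := normc_ge0 (f x); have := normc_ge0 (c x).
  have := normc_ge0 (U 0%N x).
  move: (normc (U _ _)) (normc (f x)) (normc (c x)) => u v w u0 w0 v0 uM.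
  have := mulr_ge0 w0 (ltac:(by rewrite subr_ge0) : 0 <= M - u).
  have := mulr_ge0 (ltW M0) v0; lra.
- rewrite /U' /= !UE //; apply: variation_boundary; exact: moment0.
- by apply: aeW => x _.
- by move=> x xl; rewrite /U' /= UE // green_resolventE.
Qed.

(** The solutions are bounded on [[0, l]] and every moment is at most a constant times the integral
    of [|f|], so the bound holds pointwise and uniformly in [x]. *)
Lemma green_resolvent_bound : exists2 K : R, 0 <= K & forall f, L2 l f ->
  forall x, 0 <= x <= l ->
    normc (green_resolvent f x) <= K * \int[mu]_(t in `[0, l]) normc (f t).
Proof.
have bnd (F : nat -> R -> R[i]) : (forall p, (p < 3)%N -> abs_continuous l (F p)) ->
    exists2 M : R, 0 < M & forall p x, (p < 3)%N -> 0 <= x <= l -> normc (F p x) <= M.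
  move=> acF; have [M0 M00 F0] := abs_continuous_bounded (acF 0%N isT).
  have [M1 M10 F1] := abs_continuous_bounded (acF 1%N isT).
  have [M2 M20 F2] := abs_continuous_bounded (acF 2%N isT).
  exists (M0 + M1 + M2); first by rewrite !addr_gt0.
  move=> [|[|[|//]]] x _ xl; [have := F0 x xl | have := F1 x xl | have := F2 x xl]; lra.
have [A A0 SA] := bnd (fun p => S p 0%N) (fun p p3 => @ac_S p 0%N p3 isT).
have [B B0 VB] := bnd (fun p => V p 0%N) (fun p p3 => @ac_V p 0%N p3 isT).
have ll : 0 <= l <= l by rewrite lexx ltW.
pose w := normc ('i%C / delta); pose t := normc theta.
have w0 : 0 <= w by exact: normc_ge0.
have t0 : 0 <= t by exact: normc_ge0.
pose K1 := w * (B * (2 * B) + B * (2 * B)).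
pose K2 := w * (B * (2 * B) + t * (A * (2 * B) + A * (2 * B) + A * (2 * B)) + B * (2 * B)).
(* The constant copies the expression [variation] term by term: [A], [B], [w], [t] and 1 bound [S],
   [V], i / [delta], [theta] and i, each moment counts for [2 * B], and [K1], [K2] account for the
   shifts. *)
exists ((1 * (2 * B)) * A + (1 * (2 * B) + K1) * A + (1 * (2 * B) + K2) * A).
  have [A' B'] := (ltW A0, ltW B0); rewrite /K1 /K2.
  by do ?[done | apply: addr_ge0 | apply: mulr_ge0].
move=> f L2f x xl; rewrite green_resolventE //.
set N := Rintegral _ _ _.
have P p y : (p < 3)%N -> 0 <= y <= l -> normc (moment f p y) <= 2 * B * N.
  move=> p3 yl; apply: normc_cintegralM => //; first exact: ac_V.
    exact: L2_cintegrable.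
  by move=> s sl; exact: VB.
have iN : normc ('i%C : R[i]) <= 1 by rewrite normci.
have wN : normc ('i%C / delta) <= w by [].
have tN : normc theta <= t by [].
rewrite /variation /shift1 /shift2.
have := (SA 0%N x isT xl); have := (SA 1%N x isT xl); have := (SA 2%N x isT xl).
have := (SA 0%N l isT ll); have := (SA 1%N l isT ll); have := (SA 2%N l isT ll).
have := (VB 0%N l isT ll); have := (VB 1%N l isT ll); have := (VB 2%N l isT ll).
have := (P 0%N x isT xl); have := (P 1%N x isT xl); have := (P 2%N x isT xl).
have := (P 0%N l isT ll); have := (P 1%N l isT ll); have := (P 2%N l isT ll).
move=> h1 h2 h3 h4 h5 h6 h7 h8 h9 h10 h11 h12 h13 h14 h15.
have -> : (1 * (2 * B) * A + (1 * (2 * B) + K1) * A + (1 * (2 * B) + K2) * A) * N =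
  1 * (2 * B * N) * A
  + (1 * (2 * B * N) + w * (B * (2 * B * N) + B * (2 * B * N))) * A
  + (1 * (2 * B * N) + w * (B * (2 * B * N)
      + t * (A * (2 * B * N) + A * (2 * B * N) + A * (2 * B * N)) + B * (2 * B * N))) * A.
  by rewrite /K1 /K2; ring.
by normc_tac.
Qed.

(** Since [Y 0] vanishes at 0, only [S 1] and [S 2] occur in its expansion, and the conditions at
    [l] are a homogeneous system for [Y 1 0] and [Y 2 0] with determinant [- delta]. Cramer's rule
    gives [delta * Y 1 0 = delta * Y 2 0 = 0]. *)
Lemma boundary_unique Y : jet_solution l c Y ->
  Y 0%N 0 = 0 -> Y 1%N l = theta * Y 1%N 0 -> Y 0%N l = 0 ->
  forall x, 0 <= x <= l -> Y 0%N x = 0.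
Proof.
move=> solY Y00 Y1l Y0l x xl; have ll : 0 <= l <= l by rewrite lexx ltW.
have expand k y k3 yl := solution_expand l_gt0 solS solV S0 V0 (k := k) (x := y) solY k3 yl.
have e0 := expand 0%N l isT ll; have e1 := expand 1%N l isT ll.
rewrite expand // Y00 mul0r add0r.
have [_ _ E2] := adjoint_cofactor l_gt0 solS solV S0 V0 ll.
move: e0 e1; rewrite Y0l Y1l Y00 !mul0r !add0r => e0 e1.
have d1 : delta * Y 1%N 0 = 0.
  rewrite /delta E2; transitivity (
    - S 2%N 1%N l * (Y 1%N 0 * S 1%N 0%N l + Y 2%N 0 * S 2%N 0%N l)
    + S 2%N 0%N l * (Y 1%N 0 * S 1%N 1%N l + Y 2%N 0 * S 2%N 1%N l
                     - theta * Y 1%N 0)); first by ring.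
  by rewrite -e0 -e1; ring.
have d2 : delta * Y 2%N 0 = 0.
  rewrite /delta E2; transitivity (
    (S 1%N 1%N l - theta) * (Y 1%N 0 * S 1%N 0%N l + Y 2%N 0 * S 2%N 0%N l)
    - S 1%N 0%N l * (Y 1%N 0 * S 1%N 1%N l + Y 2%N 0 * S 2%N 1%N l
                     - theta * Y 1%N 0)); first by ring.
  by rewrite -e0 -e1; ring.
move/eqP: d1; move/eqP: d2; rewrite !mulf_eq0 !(negbTE delta_neq0) /=.
by move=> /eqP -> /eqP ->; rewrite !mul0r addr0.
Qed.

End Resolvent.

(** * From the given solutions to their jets, and the resolvent formula *)

Lemma fundamental_jet (R : realType) (l : R) (q : R -> R) (mu : R[i]) (p : nat)
    (y : R -> R[i]) : fundamental_solution l q mu p y ->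
  exists Y : nat -> R -> R[i],
    [/\ jet_solution l (fun x => - 'i%C * (mu ^+ 3 - (q x)%:C)) Y,
      forall x, 0 <= x <= l -> Y 0%N x = y x &
      forall j, (j < 3)%N -> Y j 0 = (p == j)%:R].
Proof.
move=> [Y [jY Yy Y0 eY]]; exists Y; split=> //; split => //.
apply: ae_mono eY => x eY xl; have {}eY := eY xl.
rewrite -mulrA mulrBl -eY /lq_expr addrK mulNr mulrA mulii.
by ring.
Qed.

(** Conjugation restores the parameter [lambda] and fixes the real function [q], but changes -i into
    i. The coefficient thus becomes the opposite one, which is why the star solutions are taken at
    the conjugate parameter. *)
Lemma conj_jet (R : realType) (l : R) (q : R -> R) (lambda : R[i])
    (Y : nat -> R -> R[i]) :
  jet_solution l (fun x => - 'i%C * (conjc lambda ^+ 3 - (q x)%:C)) Y ->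
  jet_solution l (fun x => - (- 'i%C * (lambda ^+ 3 - (q x)%:C)))
    (fun k x => conjc (Y k x)).
Proof.
move=> /jet_solution_conj; congr jet_solution; apply/funext => x.
have zE : conjc (conjc lambda ^+ 3) = lambda ^+ 3.
  by rewrite rmorphXn; congr (_ ^+ 3); exact: conjcK.
have iE : conjc (- 'i%C) = 'i%C :> R[i].
  by apply/eqP; rewrite eq_complex /= opprK oppr0 !eqxx.
have qE : conjc (q x)%:C = (q x)%:C by exact: conjc_real.
transitivity (conjc (- 'i%C) * (conjc (conjc lambda ^+ 3) - conjc (q x)%:C)).
  by rewrite rmorphM rmorphB.
by rewrite zE iE qE mulNr opprK.
Qed.

Theorem lemma2p9 (R : realType) (l : R) (theta : R[i]) (q : R -> R)
    (s : nat -> R[i] -> R -> R[i]) (lambda : R[i])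
    (l_gt0 : 0 < l) (theta1 : `|theta| = 1)
    (q_L2 : L2 l (fun x => (q x)%:C))
    (s_sol : forall (p : nat) (mu : R[i]), (p < 3)%N ->
       fundamental_solution l q mu p (s p mu))
    (Delta_neq0 : Delta s l theta lambda != 0) :
  is_resolvent l (Lq l q theta) (lambda ^+ 3) (fun f x =>
    'i%C / Delta s l theta lambda *
    (cintegral `[0, l]%classic (fun t =>
       (G s lambda x l * star s 2%N lambda t
        - theta * G s lambda l t * s 2%N lambda x) * f t)
     + theta * cintegral `[0, x]%classic (fun t =>
         G s lambda x t * s 2%N lambda l * f t)
     - cintegral `[x, l]%classic (fun t =>
         G s lambda x t * star s 2%N lambda l * f t))).
Proof.
have jets mu : exists Y : nat -> nat -> R -> R[i], forall p, (p < 3)%N ->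
    [/\ jet_solution l (fun x => - 'i%C * (mu ^+ 3 - (q x)%:C)) (Y p),
      forall x, 0 <= x <= l -> Y p 0%N x = s p mu x &
      forall j, (j < 3)%N -> Y p j 0 = (p == j)%:R].
  have jet p : exists Y : nat -> R -> R[i], (p < 3)%N ->
      [/\ jet_solution l (fun x => - 'i%C * (mu ^+ 3 - (q x)%:C)) Y,
        forall x, 0 <= x <= l -> Y 0%N x = s p mu x &
        forall j, (j < 3)%N -> Y j 0 = (p == j)%:R].
    (* [choice] requires a value for every index; zero is a dummy for [p >= 3]. *)
    have [p3|_] := boolP (p < 3)%N; last by exists (fun _ _ => 0).
    by have [Y HY] := fundamental_jet (s_sol p mu p3); exists Y.
  by have [Y HY] := choice jet; exists Y.
have [S HS] := jets lambda; have [T HT] := jets (conjc lambda).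
pose V p k x := conjc (T p k x).
pose z := lambda ^+ 3.
have solS p : (p < 3)%N ->
    jet_solution l (fun x => - 'i%C * (z - (q x)%:C)) (S p) by move=> /HS[].
have solV p : (p < 3)%N ->
    jet_solution l (fun x => - (- 'i%C * (z - (q x)%:C))) (V p).
  by move=> /HT[jT _ _]; exact: conj_jet jT.
have S0 p j : (p < 3)%N -> (j < 3)%N -> S p j 0 = (p == j)%:R.
  by move=> /HS[_ _]; apply.
have V0 p j : (p < 3)%N -> (j < 3)%N -> V p j 0 = (p == j)%:R.
  by move=> /HT[_ _ H] j3; rewrite /V H // conjc_nat.
have Ss p x : (p < 3)%N -> 0 <= x <= l -> s p lambda x = S p 0%N x.
  by move=> /HS[_ H _] xl; rewrite H.
have Vs p x : (p < 3)%N -> 0 <= x <= l -> star s p lambda x = V p 0%N x.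
  by move=> /HT[_ H _] xl; rewrite /V H.
have ll : 0 <= l <= l by rewrite lexx ltW.
have GE x t : 0 <= x <= l -> 0 <= t <= l -> G s lambda x t = green S V x t.
  by move=> xl tl; rewrite /G /green !Ss // !Vs.
have DE : Delta s l theta lambda = - (theta * S 2%N 0%N l + V 2%N 0%N l).
  by rewrite /Delta Ss // Vs.
have d0 : - (theta * S 2%N 0%N l + V 2%N 0%N l) != 0 by rewrite -DE.
rewrite DE; set Rz := (X in is_resolvent _ _ _ X).
(* The jets agree with the given solutions on [[0, l]] only, so both the variable [x] and the
   integration variables have to be kept in that interval. *)
have RzE f x : 0 <= x <= l -> Rz f x = green_resolvent l theta S V f x.
  move=> xl; have /andP[x0 xl'] := xl; rewrite /Rz /green_resolvent.
  congr (_ * (_ + _ * _ - _)); apply: eq_cintegral => t /=; rewrite in_itv /=.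
  - by move=> tl; rewrite !GE // Vs // Ss.
  - by move=> /andP[t0 tx]; rewrite GE ?t0 ?(le_trans tx) // Ss.
  - by move=> /andP[xt tl]; rewrite GE ?tl ?(le_trans x0) // Vs.
have itv x : x \in `]0, l[ -> 0 <= x <= l.
  by rewrite in_itv /= => /andP[x0 xl]; rewrite !ltW.
have [K K0 RK] := green_resolvent_bound l_gt0 solS solV d0.
have bound f x : L2 l f -> x \in `]0, l[ ->
    normc (Rz f x) <= K * \int[lebesgue_measure]_(t in `[0, l]) normc (f t).
  by move=> L2f /itv xl; rewrite RzE // RK.
(* Measurability is inherited from the absolutely continuous solution with which [Rz f] coincides on
   the interval. *)
have mRz f : L2 l f -> cmeasurable `]0, l[%classic (Rz f).
  move=> L2f; have [U [[jU _] _ _ UE]] := resolvent_jet l_gt0 q_L2 solS solV S0 V0 d0 L2f.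
  apply: (@cmeasurable_eq _ _ (U 0%N)).
    by move=> x /itv xl; rewrite UE // RzE.
  have sub : `]0, l[%classic `<=` `[0, l]%classic by exact: subset_itv_oo_cc.
  apply: cmeasurableS sub _ => //.
  by apply: abs_continuous_measurable; exact: ac_jet3_abs_continuous jU _.
have L2Rz f : L2 l f -> L2 l (Rz f).
  move=> L2f; apply: (L2_bounded l_gt0 (mRz f L2f)) => x xl; exact: bound L2f xl.
have L2comb (a : R[i]) f g : L2 l f -> L2 l g -> L2 l (fun x => f x + a * g x).
  move=> L2f L2g; have [mf _] := L2f; have [mg _] := L2g.
  apply: (L2_dominated (K := 1 + normc a) _ L2f L2g).
    by apply: cmeasurableD => //; apply: cmeasurableM => //; exact: cmeasurable_cst.
  move=> x _; apply: le_trans (normcD _ _) _.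
  rewrite ComplexField.Normc.normcM.
  have := mulr_ge0 (normc_ge0 a) (normc_ge0 (f x)).
  have := normc_ge0 (g x); rewrite mulrDl mul1r mulrDr; lra.
split => //.
(* One factor [sqrt l] comes from passing from the uniform bound to the norm of [Rz f], the other
   from bounding the integral of [|f|] by its norm. *)
- exists (K * l) => f L2f.
  have N0 : 0 <= \int[lebesgue_measure]_(t in `[0, l]) normc (f t).
    by apply: Rintegral_ge0 => t _; exact: normc_ge0.
  apply: (@le_trans _ _ ((K * (\int[lebesgue_measure]_(t in `[0, l]) normc (f t))
      * Num.sqrt l)%:E)).
    apply: L2norm_bounded => //; [exact: mRz | exact: mulr_ge0 |].
    by move=> x xl; exact: bound.
  have := Rintegral_normc_le l_gt0 L2f.
  set N := Rintegral _ _ _ => Nle.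
  have -> : K * N * Num.sqrt l = (K * Num.sqrt l) * N by ring.
  rewrite EFinM; apply: le_trans (lee_wpmul2l _ Nle) _.
    by rewrite lee_fin mulr_ge0 // sqrtr_ge0.
  rewrite [X in (_ * X)%E]muleC muleA -EFinM -mulrA -expr2 sqr_sqrtr //.
  exact: ltW.
- move=> f L2f.
  have [U [jU bc eU UE]] := resolvent_jet l_gt0 q_L2 solS solV S0 V0 d0 L2f.
  split; [exact: L2Rz | exact: L2comb (L2Rz f L2f) |].
  exists U; split => //.
    by apply: aeW => x /itv xl; rewrite UE // RzE.
  apply: ae_mono eU => x eU xl; have {}eU := eU xl.
  rewrite /lq_expr eU RzE ?itv // -UE ?itv // -/z.
  rewrite mulrDr !mulrA mulrN mulii; ring.
- move=> y g [L2y L2g [Y [[jY _] yY [Y00 Y1l Y0l] gY]]].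
  pose f x := g x - z * y x.
  have L2f : L2 l f.
    have := L2comb (- z) _ _ L2g L2y; congr L2; apply/funext => x.
    by rewrite /f mulNr.
  have [U [[jU _] [U00 U1l U0l] eU UE]] := resolvent_jet l_gt0 q_L2 solS solV S0 V0 d0 L2f.
  (* [Y] and the constructed [U] solve the same inhomogeneous problem with right-hand side [f], so
     their difference solves the homogeneous boundary value problem and vanishes. *)
  have W : jet_solution l (fun x => - 'i%C * (z - (q x)%:C)) (fun k x => Y k x - U k x).
    split; first exact: ac_jet3B.
    apply: ae_mono (ae_and eU (ae_and yY gY)) => x [eU' [yY' gY']] xl.
    have := gY' xl; have := yY' xl; rewrite (eU' xl) /f /lq_expr => -> ->.
    (* For [ring] the imaginary unit is an indeterminate; the two sides differ by (i^2 + 1) [Y 3 x],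
       which is therefore inserted by hand. *)
    have ii1 : 'i%C * 'i%C + 1 = 0 :> R[i] by rewrite mulii addNr.
    by rewrite -[RHS]addr0 -(mul0r (Y 3%N x)) -ii1; ring.
  have W0 x : 0 <= x <= l -> Y 0%N x - U 0%N x = 0.
    move=> xl.
    apply: (boundary_unique l_gt0 solS solV S0 V0 d0 W) => //.
    + by rewrite Y00 U00 subrr.
    + by rewrite Y1l U1l mulrBr.
    + by rewrite Y0l U0l subrr.
  apply: ae_mono yY => x yY xl; rewrite yY // RzE ?itv // -UE ?itv //.
  by apply/esym/subr0_eq/W0; exact: itv.
Qed.
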